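(* Let $A$ and $C$ be $\Delta^0_2$ sets such that $C \not\leq_{\mathrm{T}} \emptyset$ (i.e. $C$ is not computable). If $G$ is any $2$-generic set, then $G\oplus\emptyset'$ computes an infinite subset $H$ of $A$ or of $\overline{A}$ such that $C\not\leq_{\mathrm{T}} H$.
   Context: All sets are subsets of $\omega$; $\overline{A}=\omega\setminus A$; $\leq_{\mathrm{T}}$ is Turing reducibility. A set $G$ is $2$-generic if for every $\Sigma^0_2$ set $S$ of finite binary strings, some initial segment of $G$ either belongs to $S$ or has no extension in $S$. *)

(* Defs.v *)
From mathcomp Require Import all_boot.
From mathcomp Require Import boolp classical_sets cardinality.
From Stdlib Require Cantor.

Set Implicit Arguments.
Unset Strict Implicit.
Unset Printing Implicit Defensive.

Local Open Scope classical_set_scope.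

Definition npair (x y : nat) : nat := Cantor.to_nat (x, y).
Definition nfst (n : nat) : nat := (Cantor.of_nat n).1.
Definition nsnd (n : nat) : nat := (Cantor.of_nat n).2.

(* Unary partial recursive functions with an oracle; functions of several
   arguments are unary functions of a paired argument. *)
Inductive code : Type :=
| Zero
| Succ
| Fst
| Snd
| Oracle
| Pair of code & code
| Comp of code & code
| Prec of code & code
| Mu of code.

(* [eval X c n v] : the program c with oracle X halts on input n with value v.
   [Prec f g] maps <a, k> to h k, where h 0 = f a, h k.+1 = g <a, <k, h k>>;
   [Mu f] maps a to the least k such that f <a, k> = 0, and diverges if
   f <a, j> diverges for some j below that k. *)
Fixpoint eval (X : set nat) (c : code) : nat -> nat -> Prop :=
  match c with
  | Zero => fun _ v => v = 0
  | Succ => fun n v => v = n.+1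
  | Fst => fun n v => v = nfst n
  | Snd => fun n v => v = nsnd n
  | Oracle => fun n v => v = `[< X n >]
  | Pair f g => fun n v =>
      exists x y, [/\ eval X f n x, eval X g n y & v = npair x y]
  | Comp f g => fun n v => exists2 m, eval X g n m & eval X f m v
  | Prec f g => fun n v =>
      (fix iter_prec (k w : nat) : Prop :=
         match k with
         | 0 => eval X f (nfst n) w
         | k'.+1 => exists2 u, iter_prec k' u
                       & eval X g (npair (nfst n) (npair k' u)) w
         end) (nsnd n) v
  | Mu f => fun n v =>
      eval X f (npair n v) 0 /\
      forall j, j < v -> exists w, eval X f (npair n j) w.+1
  end.

Definition turing_le (A B : set nat) : Prop :=
  exists c, forall n, eval B c n `[< A n >].

Definition computable (A : set nat) : Prop := turing_le A set0.

(* An effective bijection between programs and natural numbers. *)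
Fixpoint godel (c : code) : nat :=
  match c with
  | Zero => 0
  | Succ => 1
  | Fst => 2
  | Snd => 3
  | Oracle => 4
  | Pair f g => 5 + 4 * npair (godel f) (godel g)
  | Comp f g => 6 + 4 * npair (godel f) (godel g)
  | Prec f g => 7 + 4 * npair (godel f) (godel g)
  | Mu f => 8 + 4 * godel f
  end.

Definition jump (X : set nat) : set nat :=
  [set e | exists c, godel c = e /\ exists v, eval X c e v].

Definition join (A B : set nat) : set nat :=
  [set n | if odd n then B n./2 else A n./2].

Definition Sigma02 (A : set nat) : Prop :=
  exists R : set nat, computable R /\
    forall x, A x <-> exists y, forall z, R (npair x (npair y z)).

Definition Delta02 (A : set nat) : Prop := Sigma02 A /\ Sigma02 (~` A).

(* An effective bijection between finite binary strings and natural numbers: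
   bijective base-2 numeration, with digits 1 (false) and 2 (true) and the head
   of the list as least significant digit. *)
Definition string_code (s : seq bool) : nat :=
  foldr (fun (b : bool) m => b + m.*2.+1) 0 s.

Definition Sigma02_strings (S : set (seq bool)) : Prop :=
  Sigma02 (string_code @` S).

Definition initial_segment (s : seq bool) (G : set nat) : Prop :=
  forall i, i < size s -> (nth false s i <-> G i).

Definition two_generic (G : set nat) : Prop :=
  forall S : set (seq bool), Sigma02_strings S ->
    exists s, initial_segment s G /\
      (S s \/ forall t, prefix s t -> ~ S t).

(* Main.v *)
Require Import Defs.
From mathcomp Require Import all_boot zify.
From mathcomp Require Import boolp classical_sets cardinality.
From Stdlib Require Cantor.

(* Seetapun forcing with finitely many nested reservoirs. A pair (e, i) of
   functionals asks for Phi_e(H0) <> C or Phi_i(H1) <> C, where H0 is a subset of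
   A and H1 of its complement. Given finite parts D0, D1 and a reservoir X, either
   every partition X = Z0 + Z1 contains an e-splitting over D0 inside Z0 or an
   i-splitting over D1 inside Z1 (then so does the partition by A, and one half
   of that splitting computes C wrongly), or some partition has none, and a
   future restricted to Z0 (to Z1) keeps Phi_e(H0) (Phi_i(H1)) computable from the
   reservoir whenever it is total. All partitions are taken from the columns of
   one low set M that does not compute C, obtained from a Pi01 class by the low
   basis theorem with cone avoidance; hence the jump of the empty set decides
   every question about reservoirs.

   It cannot decide which of Z0, Z1 is infinite. So G guesses, and a reservoir
   found to be exhausted is popped from a stack of reservoirs. If Z0 is finite,
   then X itself, above a large bound, has no i-splitting, which can be declared
   without shrinking X. By 2-genericity, either G makes such a declaration, or
   some initial segment of G excludes it for good; after that segment both sides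
   of every partition of X used are infinite. Thus each level of the stack
   stabilizes on an infinite reservoir, and one of H0, H1 does not compute C. They
   are infinite unless some reservoir is almost contained in A or in its
   complement, in which case its tail is as required. *)

Set Implicit Arguments.
Unset Strict Implicit.
Unset Printing Implicit Defensive.

Local Open Scope classical_set_scope.

(** * Recursive functions and decidable predicates *)

#[global] Arguments npair : simpl never.
#[global] Arguments nfst : simpl never.
#[global] Arguments nsnd : simpl never.

Lemma nfstK x y : nfst (npair x y) = x.
Proof. by rewrite /nfst /npair Cantor.cancel_of_to. Qed.

Lemma nsndK x y : nsnd (npair x y) = y.
Proof. by rewrite /nsnd /npair Cantor.cancel_of_to. Qed.

Lemma npairK n : npair (nfst n) (nsnd n) = n.
Proof.
by rewrite /nfst /nsnd /npair -surjective_pairing Cantor.cancel_to_of.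
Qed.

Lemma npair_double x y : (npair x y).*2 = y.*2 + (y + x) * (y + x).+1.
Proof. have := Cantor.to_nat_spec x y; rewrite /npair; lia. Qed.

Lemma npair_mono x y x' y' : x <= x' -> y <= y' -> npair x y <= npair x' y'.
Proof.
move=> lex ley; rewrite -leq_double !npair_double.
by rewrite leq_add ?leq_mul ?ltnS ?leq_add ?leq_double.
Qed.

Lemma leq_npair1 x y : x <= npair x y.
Proof. have := npair_double x y; nia. Qed.

Lemma leq_npair2 x y : y <= npair x y.
Proof. have := npair_double x y; nia. Qed.

Lemma nfst_le n : nfst n <= n.
Proof. by have := leq_npair1 (nfst n) (nsnd n); rewrite npairK. Qed.

Lemma nsnd_le n : nsnd n <= n.
Proof. by have := leq_npair2 (nfst n) (nsnd n); rewrite npairK. Qed.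

Lemma npair_inj x y x' y' : npair x y = npair x' y' -> x = x' /\ y = y'.
Proof.
move=> h; have := (congr1 nfst h, congr1 nsnd h).
by rewrite !nfstK !nsndK => -[].
Qed.

Definition recf (X : set nat) (f : nat -> nat) : Prop :=
  exists c, forall n, eval X c n (f n).

Definition recp (X : set nat) (P : nat -> Prop) : Prop :=
  recf X (fun n => `[< P n >] : nat).

Lemma recf_ext X f g : f =1 g -> recf X f -> recf X g.
Proof. by move=> /funext <-. Qed.

Lemma recp_iff X P Q : (forall n, P n <-> Q n) -> recp X P -> recp X Q.
Proof.
by move=> PQ; have -> : P = Q by apply/funext => n; apply/propext.
Qed.

Lemma recf_id X : recf X (fun n => n).
Proof.
exists (Pair Fst Snd) => n /=; exists (nfst n), (nsnd n).
by rewrite npairK.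
Qed.

Lemma recf_comp X f g : recf X f -> recf X g -> recf X (fun n => f (g n)).
Proof. by move=> [c hc] [d hd]; exists (Comp c d) => n /=; exists (g n). Qed.

Lemma recf_const X k : recf X (fun=> k).
Proof.
elim: k => [|k [c hc]]; first by exists Zero.
by exists (Comp Succ c) => n /=; exists k.
Qed.

Lemma recf_succ X f : recf X f -> recf X (fun n => (f n).+1).
Proof. by apply: (@recf_comp X S); exists Succ. Qed.

Lemma recf_nfst X f : recf X f -> recf X (fun n => nfst (f n)).
Proof. by apply: (@recf_comp X nfst); exists Fst. Qed.

Lemma recf_nsnd X f : recf X f -> recf X (fun n => nsnd (f n)).
Proof. by apply: (@recf_comp X nsnd); exists Snd. Qed.

Lemma recf_npair X f g :
  recf X f -> recf X g -> recf X (fun n => npair (f n) (g n)).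
Proof.
by move=> [c hc] [d hd]; exists (Pair c d) => n /=; exists (f n), (g n).
Qed.

Lemma recf_comp2 X h f g : recf X (fun p => h (nfst p) (nsnd p)) ->
  recf X f -> recf X g -> recf X (fun n => h (f n) (g n)).
Proof.
move=> rh rf rg; have := recf_comp rh (recf_npair rf rg).
by apply: recf_ext => n; rewrite nfstK nsndK.
Qed.

Lemma recp_comp X P f : recp X P -> recf X f -> recp X (fun n => P (f n)).
Proof. by rewrite /recp => rP rf; exact: (recf_comp rP rf). Qed.

Lemma recp_comp2 X (P : nat -> nat -> Prop) f g :
  recp X (fun p => P (nfst p) (nsnd p)) ->
  recf X f -> recf X g -> recp X (fun n => P (f n) (g n)).
Proof.
by rewrite /recp => rP rf rg;
  exact: (@recf_comp2 _ (fun a b => nat_of_bool `[< P a b >])).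
Qed.

Fixpoint prim (h : nat -> nat -> nat) (x k : nat) : nat :=
  if k is k'.+1 then h k' (prim h x k') else x.

Lemma recf_prim X h f g :
  recf X (fun p => h (nfst p) (nfst (nsnd p)) (nsnd (nsnd p))) ->
  recf X f -> recf X g -> recf X (fun n => prim (h n) (f n) (g n)).
Proof.
move=> [c hc] [d hd] rg.
have rP : recf X (fun p => prim (h (nfst p)) (f (nfst p)) (nsnd p)).
  exists (Prec d c) => n /=; move: (nsnd n) => k.
  elim: k => [|k IH] /=; first exact: hd.
  exists (prim (h (nfst n)) (f (nfst n)) k) => //.
  by have := hc (npair (nfst n) (npair k (prim (h (nfst n)) (f (nfst n)) k)));
    rewrite !(nfstK, nsndK).
have := recf_comp rP (recf_npair (recf_id X) rg).
by apply: recf_ext => n; rewrite nfstK nsndK.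
Qed.

(* Each hook is filled once the corresponding closure lemmas are available. *)
Ltac rec_arith := fail.
Ltac rec_logic := fail.
Ltac rec_list := fail.
Ltac rec_derivation := fail.
Ltac rec_state := fail.
Ltac rec_var := match goal with
  | H : recf _ ?f |- _ =>
      first [is_var f | is_const f]; simple refine (recf_comp H _)
  | H : recp _ ?P |- _ =>
      first [is_var P | is_const P]; simple refine (recp_comp H _)
  | H : recf _ (fun p => ?h (nfst p) (nsnd p)) |- _ =>
      first [is_var h | is_const h]; simple refine (@recf_comp2 _ h _ _ H _ _)
  | H : recp _ (fun p => ?h (nfst p) (nsnd p)) |- _ =>
      first [is_var h | is_const h]; simple refine (@recp_comp2 _ h _ _ H _ _)
  end.
Ltac rec_step := first
  [ assumption | simple apply recf_id | simple apply recf_const | rec_state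
  | simple apply recf_succ | simple apply recf_nfst | simple apply recf_nsnd
  | simple apply recf_npair | simple apply recf_prim
  | rec_arith | rec_logic | rec_list | rec_derivation | rec_var ].
Ltac rec := cbv beta; solve [repeat rec_step].

Lemma recf_iter X h f g : recf X (fun p => h (nfst p) (nsnd p)) ->
  recf X f -> recf X g -> recf X (fun n => iter (g n) (h n) (f n)).
Proof.
move=> rh rf rg.
apply: (@recf_ext _ (fun n => prim (fun _ a => h n a) (f n) (g n))).
  by move=> n; elim: (g n) => //= k ->.
apply: recf_prim => //.
by apply: (@recf_comp2 X h); rec.
Qed.

Lemma recf_pred X f : recf X f -> recf X (fun n => (f n).-1).
Proof.
apply: (@recf_comp X predn).
apply: (@recf_ext _ (fun n => prim (fun k _ => k) 0 n)); first by case.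
by rec.
Qed.

Lemma recf_add X f g : recf X f -> recf X g -> recf X (fun n => f n + g n).
Proof.
apply: (@recf_comp2 X addn).
apply: (@recf_ext _ (fun p => iter (nsnd p) S (nfst p))).
  by move=> n; rewrite iter_succn.
by apply: recf_iter; rec.
Qed.

Lemma recf_sub X f g : recf X f -> recf X g -> recf X (fun n => f n - g n).
Proof.
apply: (@recf_comp2 X subn).
apply: (@recf_ext _ (fun p => iter (nsnd p) predn (nfst p))).
  by move=> n; elim: (nsnd n) => [|k IH] /=; rewrite ?subn0 // IH subnS.
by apply: recf_iter; [apply: recf_pred|..]; rec.
Qed.

Lemma recf_mul X f g : recf X f -> recf X g -> recf X (fun n => f n * g n).
Proof.
apply: (@recf_comp2 X muln).
apply: (@recf_ext _ (fun p => iter (nsnd p) (fun a => nfst p + a) 0)).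
  by move=> n; rewrite iter_addn_0.
apply: recf_iter; [apply: recf_add|..]; rec.
Qed.
Ltac rec_arith ::= first
  [ simple apply recf_iter | simple apply recf_pred | simple apply recf_add
  | simple apply recf_sub | simple apply recf_mul ].

Lemma recp_const X (P : Prop) : recp X (fun=> P).
Proof. exact: recf_const. Qed.

Lemma recp_eq0 X f : recf X f -> recp X (fun n => f n = 0).
Proof.
move=> rf; apply: (@recf_ext _ (fun n => 1 - f n)); last by rec.
by move=> n; case: asboolP; lia.
Qed.

Lemma recp_not X P : recp X P -> recp X (fun n => ~ P n).
Proof.
rewrite /recp => rP; apply: (@recf_ext _ (fun n => 1 - `[< P n >])); last by rec.
by move=> n; rewrite asbool_neg; case: asbool.
Qed.

Lemma recp_and X P Q : recp X P -> recp X Q -> recp X (fun n => P n /\ Q n).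
Proof.
rewrite /recp => rP rQ.
apply: (@recf_ext _ (fun n => `[< P n >] * `[< Q n >])); last by rec.
by move=> n; rewrite asbool_and; do 2 case: asbool.
Qed.

Lemma recp_or X P Q : recp X P -> recp X Q -> recp X (fun n => P n \/ Q n).
Proof.
move=> rP rQ; apply: (@recp_iff _ (fun n => ~ (~ P n /\ ~ Q n))); last first.
  by apply/recp_not/recp_and; exact: recp_not.
by move=> n; rewrite not_andE !not_notE.
Qed.

Lemma recp_imp X (P Q : nat -> Prop) :
  recp X P -> recp X Q -> recp X (fun n => P n -> Q n).
Proof.
move=> rP rQ; apply: (@recp_iff _ (fun n => ~ (P n /\ ~ Q n))); last first.
  by apply/recp_not/recp_and => //; exact: recp_not.
by move=> n; rewrite not_andE not_notE implyE.
Qed.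

Lemma recp_le X f g : recf X f -> recf X g -> recp X (fun n => f n <= g n).
Proof.
move=> rf rg; apply: (@recp_iff _ (fun n => f n - g n = 0)); last first.
  by apply: recp_eq0; rec.
by move=> n; lia.
Qed.

Lemma recp_eq X f g : recf X f -> recf X g -> recp X (fun n => f n = g n).
Proof.
move=> rf rg; apply: (@recp_iff _ (fun n => f n <= g n /\ g n <= f n)); last first.
  by apply: recp_and; exact: recp_le.
by move=> n; lia.
Qed.

Lemma recp_ball X (P : nat -> nat -> Prop) g :
  recf X g -> recp X (fun p => P (nfst p) (nsnd p)) ->
  recp X (fun n => forall k, k < g n -> P n k).
Proof.
rewrite /recp => rg rP.
apply: (@recf_ext _
  (fun n => prim (fun k a => a * `[< P n k >]) 1 (g n))); last first.
  apply: recf_prim; [|by rec..].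
  apply: recf_mul; first by rec.
  by apply: (@recf_comp2 _ (fun a b => nat_of_bool `[< P a b >])); rec.
move=> n; elim: (g n) => [|k /= ->]; first by rewrite asboolT.
have -> : (forall i, i < k.+1 -> P n i) = ((forall i, i < k -> P n i) /\ P n k).
  apply/propext; split=> [h|[h Pk] i].
    by split=> [i ik|]; apply: h => //; exact: ltnW.
  by rewrite ltnS leq_eqVlt => /orP[/eqP->|/h].
by rewrite asbool_and; do 2 case: asbool.
Qed.

Lemma recp_bex X (P : nat -> nat -> Prop) g :
  recf X g -> recp X (fun p => P (nfst p) (nsnd p)) ->
  recp X (fun n => exists k, k < g n /\ P n k).
Proof.
move=> rg rP.
apply: (@recp_iff _ (fun n => ~ (forall k, k < g n -> ~ P n k))); last first.
  by apply/recp_not/recp_ball => //; exact: recp_not.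
move=> n; split=> [|[k [kg Pk]] h]; last exact: (h k).
by move=> /existsNP[k /not_implyP[kg /contrapT Pk]]; exists k.
Qed.

Lemma recf_if X P f g : recp X P -> recf X f -> recf X g ->
  recf X (fun n => if `[< P n >] then f n else g n).
Proof.
rewrite /recp => rP rf rg.
apply: (@recf_ext _
  (fun n => `[< P n >] * f n + (1 - `[< P n >]) * g n)); last by rec.
by move=> n; case: asbool; lia.
Qed.

Lemma recf_asbool X P : recp X P -> recf X (fun n => nat_of_bool `[< P n >]).
Proof. by []. Qed.
Ltac rec_logic ::= first
  [ simple apply recp_const | simple apply recp_eq0 | simple apply recp_not
  | simple apply recp_and | simple apply recp_or | simple apply recp_imp
  | simple apply recp_le | simple apply recp_eq | simple apply recp_ball
  | simple apply recp_bex | simple apply recf_if | simple apply recf_asbool ].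

Lemma recf_choose X (P : nat -> nat -> Prop) :
  recp X (fun p => P (nfst p) (nsnd p)) -> (forall n, exists k, P n k) ->
  exists f, recf X f /\ forall n, P n (f n).
Proof.
move=> rP ex; have [c hc] := recp_not rP.
have exb n : exists k, `[< P n k >] by have [k Pk] := ex n; exists k; apply/asboolP.
exists (fun n => ex_minn (exb n)); split; last first.
  by move=> n; case: ex_minnP => k /asboolP.
exists (Mu c) => n /=; case: ex_minnP => m /asboolP Pm min; split.
  by have := hc (npair n m); rewrite nfstK nsndK asbool_neg; case: asboolP.
move=> j jm; exists 0; have := hc (npair n j).
rewrite nfstK nsndK asbool_neg; case: asboolP => // /asboolP /min.
by rewrite leqNgt jm.
Qed.

Lemma recp_oracle X : recp X X.
Proof. by exists Oracle. Qed.

Lemma eval_det X c n v w : eval X c n v -> eval X c n w -> v = w.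
Proof.
elim: c n v w => [||||| f IHf g IHg | f IHf g IHg | f IHf g IHg | f IHf] n v w /=.
- by move=> -> ->.
- by move=> -> ->.
- by move=> -> ->.
- by move=> -> ->.
- by move=> -> ->.
- move=> [x [y [fx gy ->]]] [x' [y' [fx' gy' ->]]].
  by rewrite (IHf _ _ _ fx fx') (IHg _ _ _ gy gy').
- move=> [m gm fm] [m' gm' fm']; apply: IHf fm _.
  by rewrite (IHg _ _ _ gm gm').
- elim: (nsnd n) v w => [|k IHk] v w; first exact: IHf.
  move=> [u hu gu] [u' hu' gu']; apply: IHg gu _.
  by rewrite (IHk _ _ hu hu').
- move=> [fv hv] [fw hw]; case: (ltngtP v w) => // lt.
    by have [u hu] := hw _ lt; have := IHf _ _ _ fv hu.
  by have [u hu] := hv _ lt; have := IHf _ _ _ fw hu.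
Qed.

Fixpoint subst_oracle (d c : code) : code :=
  match c with
  | Oracle => d
  | Pair f g => Pair (subst_oracle d f) (subst_oracle d g)
  | Comp f g => Comp (subst_oracle d f) (subst_oracle d g)
  | Prec f g => Prec (subst_oracle d f) (subst_oracle d g)
  | Mu f => Mu (subst_oracle d f)
  | c => c
  end.

Lemma eval_subst A B d c n v : (forall m, eval B d m `[< A m >]) ->
  eval A c n v -> eval B (subst_oracle d c) n v.
Proof.
move=> hd.
elim: c n v => [||||| f IHf g IHg | f IHf g IHg | f IHf g IHg | f IHf] n v //=.
- by move=> ->.
- by move=> [x [y [fx gy ->]]]; exists x, y; split; auto.
- by move=> [m gm fm]; exists m; auto.
- elim: (nsnd n) v => [|k IHk] v; first exact: IHf.
  by move=> [u hu gu]; exists u; [exact: IHk | exact: IHg].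
- move=> [fv hv]; split; first exact: IHf.
  by move=> j /hv[w fw]; exists w; exact: IHf.
Qed.

Lemma recf_trans A B f : recp B A -> recf A f -> recf B f.
Proof.
by move=> [d hd] [c hc]; exists (subst_oracle d c) => n; exact: eval_subst.
Qed.

Lemma recp_trans A B P : recp B A -> recp A P -> recp B P.
Proof. exact: recf_trans. Qed.

(** * Derivations of computations *)

Definition lcons (x l : nat) : nat := (npair x l).+1.
Definition hd (l : nat) : nat := nfst l.-1.
Definition tl (l : nat) : nat := nsnd l.-1.
Definition lst (s : seq nat) : nat := foldr lcons 0 s.

#[global] Arguments lcons : simpl never.
#[global] Arguments hd : simpl never.
#[global] Arguments tl : simpl never.

Lemma hd_cons x l : hd (lcons x l) = x.
Proof. exact: nfstK. Qed.

Lemma tl_cons x l : tl (lcons x l) = l.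
Proof. exact: nsndK. Qed.

Lemma npair00 : npair 0 0 = 0.
Proof. by have := npair_double 0 0; lia. Qed.

Lemma tl0 : tl 0 = 0.
Proof. by have := nsndK 0 0; rewrite npair00. Qed.

Lemma lcons_hd_tl l : l <> 0 -> lcons (hd l) (tl l) = l.
Proof. by case: l => // l _; rewrite /lcons npairK. Qed.

Lemma tl_lt l : l <> 0 -> tl l < l.
Proof. by case: l => // l _; rewrite ltnS nsnd_le. Qed.

Lemma lst_surj l : exists s, l = lst s.
Proof.
elim/ltn_ind: l => l IH; have [->|/eqP l0] := eqVneq l 0; first by exists [::].
have [s hs] := IH _ (tl_lt l0).
by exists (hd l :: s); rewrite /= -/(lst s) -hs lcons_hd_tl.
Qed.

Lemma iter_tl_ge t l : l <= t -> iter t tl l = 0.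
Proof.
elim: t l => [|t IH] l; first by rewrite leqn0 => /eqP.
move=> lt; rewrite iterSr; apply: IH; have [->|/eqP/tl_lt] := eqVneq l 0.
  by rewrite tl0.
by lia.
Qed.

Lemma forall_suffix (Q : nat -> Prop) x s :
  (forall t, t < lst (x :: s) -> iter t tl (lst (x :: s)) <> 0 ->
     Q (iter t tl (lst (x :: s)))) <->
  Q (lst (x :: s)) /\
  (forall t, t < lst s -> iter t tl (lst s) <> 0 -> Q (iter t tl (lst s))).
Proof.
have bnd l t : iter t tl l <> 0 -> t < l.
  by move=> h; rewrite ltnNge; apply/negP => /iter_tl_ge.
split=> [h|[Q0 h] [|t] _ t0 //].
  split; first exact: (h 0).
  move=> t _ t0; have := h t.+1; rewrite iterSr tl_cons; apply => //.
  by apply: bnd; rewrite iterSr tl_cons.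
rewrite iterSr tl_cons in t0 *; apply: h => //; exact: bnd.
Qed.

Definition lmem (y l : nat) : Prop :=
  exists t, t < l /\ (iter t tl l <> 0 /\ hd (iter t tl l) = y).

Lemma lmem_lst y s : lmem y (lst s) <-> y \in s.
Proof.
elim: s => [|x s IH]; first by split=> // -[t []].
have := forall_suffix (fun l => hd l <> y) x s; rewrite /= -/(lst s) hd_cons.
have lmemE l : lmem y l <->
    ~ (forall t, t < l -> iter t tl l <> 0 -> hd (iter t tl l) <> y).
  split=> [[t [tl_ [t0 ty]]] h|]; first exact: (h t).
  move=> /existsNP[t /not_implyP[tl_ /not_implyP[t0 /contrapT ty]]].
  by exists t.
move=> e; rewrite lmemE e not_andE not_notE -lmemE IH inE.
split=> [[->|->]|/orP[/eqP ->|->]]; rewrite ?eqxx ?orbT //; [by left|by right].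
Qed.

Lemma lmem_cons y x l : lmem y (lcons x l) <-> y = x \/ lmem y l.
Proof.
have [s ->] := lst_surj l; rewrite (lmem_lst y (x :: s)) lmem_lst inE.
by split=> [/orP[/eqP|]|[->|->]]; rewrite ?eqxx ?orbT; auto.
Qed.

Lemma lmem0 y : ~ lmem y 0.
Proof. by move=> [t []]. Qed.

Lemma lmem_lt y l : lmem y l -> y < l.
Proof.
have [s ->] := lst_surj l; rewrite lmem_lst; elim: s => // x s IH.
rewrite inE => /orP[/eqP ->|/IH]; rewrite /= -/(lst s) /lcons.
  by rewrite ltnS leq_npair1.
by have := leq_npair2 x (lst s); lia.
Qed.

Lemma recf_lcons X f g :
  recf X f -> recf X g -> recf X (fun n => lcons (f n) (g n)).
Proof. by move=> rf rg; apply: recf_succ; rec. Qed.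

Lemma recf_hd X f : recf X f -> recf X (fun n => hd (f n)).
Proof. by move=> rf; apply: recf_nfst; rec. Qed.

Lemma recf_tl X f : recf X f -> recf X (fun n => tl (f n)).
Proof. by move=> rf; apply: recf_nsnd; rec. Qed.

Lemma recp_lmem X f g :
  recf X f -> recf X g -> recp X (fun n => lmem (f n) (g n)).
Proof.
apply: (@recp_comp2 X lmem); by rewrite /lmem /hd /tl; rec.
Qed.

(* A fact [ent e n v] says that the program number [e] maps [n] to [v]. *)
Definition ent (e n v : nat) : nat := npair e (npair n v).

Lemma recf_ent X f g h : recf X f -> recf X g -> recf X h ->
  recf X (fun n => ent (f n) (g n) (h n)).
Proof. by move=> rf rg rh; rewrite /ent; rec. Qed.
Ltac rec_list ::= first
  [ simple apply recf_lcons | simple apply recf_hd | simple apply recf_tl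
  | simple apply recp_lmem | simple apply recf_ent ].

Lemma ent_inj e n v e' n' v' :
  ent e n v = ent e' n' v' -> [/\ e = e', n = n' & v = v'].
Proof. by move=> /npair_inj[-> /npair_inj[-> ->]]. Qed.

Lemma entK y : ent (nfst y) (nfst (nsnd y)) (nsnd (nsnd y)) = y.
Proof. by rewrite /ent !npairK. Qed.

Lemma ent_ge e n v : [/\ e <= ent e n v, n <= ent e n v & v <= ent e n v].
Proof.
rewrite /ent; have := leq_npair1 e (npair n v); have := leq_npair2 e (npair n v).
by have := leq_npair1 n v; have := leq_npair2 n v; split; lia.
Qed.

(* The fact [ent e n v] follows in one step from facts in the list [T], where
   oracle answers are accepted without further justification. *)
Definition justified (T e n v : nat) : Prop :=
  (e = 0 /\ v = 0) \/ (e = 1 /\ v = n.+1) \/ (e = 2 /\ v = nfst n) \/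
  (e = 3 /\ v = nsnd n) \/ e = 4 \/
  exists k, k < e /\
  ((e = 5 + 4 * k /\ lmem (ent (nfst k) n (nfst v)) T /\
      lmem (ent (nsnd k) n (nsnd v)) T) \/
   (e = 6 + 4 * k /\ exists m, m < T /\
      (lmem (ent (nsnd k) n m) T /\ lmem (ent (nfst k) m v) T)) \/
   (e = 7 + 4 * k /\
      ((nsnd n = 0 /\ lmem (ent (nfst k) (nfst n) v) T) \/
       (nsnd n <> 0 /\ exists u, u < T /\
         (lmem (ent e (npair (nfst n) (nsnd n).-1) u) T /\
          lmem (ent (nsnd k) (npair (nfst n) (npair (nsnd n).-1 u)) v) T)))) \/
   (e = 8 + 4 * k /\ lmem (ent k (npair n v) 0) T /\
      forall j, j < v -> exists w, w < T /\ lmem (ent k (npair n j) w.+1) T)).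

Definition valid (L : nat) : Prop :=
  forall t, t < L -> iter t tl L <> 0 ->
    (fun l => justified (tl l) (nfst (hd l)) (nfst (nsnd (hd l)))
                (nsnd (nsnd (hd l)))) (iter t tl L).

Lemma recp_valid X f : recf X f -> recp X (fun n => valid (f n)).
Proof.
by apply: (@recp_comp X valid); rewrite /valid /justified; rec.
Qed.
Ltac rec_derivation ::= first
  [ simple apply recp_valid ].

Definition consist (X : set nat) (L : nat) : Prop :=
  forall y, y < L -> lmem y L -> nfst y = 4 ->
    nsnd (nsnd y) = `[< X (nfst (nsnd y)) >].

Lemma recp_consist X (Y : nat -> nat -> Prop) f :
  recp X (fun p => Y (nfst p) (nsnd p)) -> recf X f ->
  recp X (fun n => consist (Y n) (f n)).
Proof.
by move=> rY rf; rewrite /consist; rec.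
Qed.

Lemma valid_cons e n v s : valid (lst (ent e n v :: s)) <->
  justified (lst s) e n v /\ valid (lst s).
Proof.
apply: (iff_trans (forall_suffix (fun l => justified (tl l) (nfst (hd l))
  (nfst (nsnd (hd l))) (nsnd (nsnd (hd l)))) _ _)).
by rewrite /= -/(lst s) hd_cons tl_cons /ent !(nfstK, nsndK).
Qed.

Lemma consistP X L : consist X L <->
  (forall n v, lmem (ent 4 n v) L -> v = `[< X n >]).
Proof.
split=> h.
  move=> n v nvL; have := h _ (lmem_lt nvL) nvL.
  by rewrite /ent !(nfstK, nsndK); apply.
by move=> y _ yL y4; apply: h; rewrite -y4 entK.
Qed.

Lemma godel_surj e : exists c, godel c = e.
Proof.
elim/ltn_ind: e => e IH.
have [|e5] := ltnP e 5.
  case: e IH => [|[|[|[|[|e]]]]] // _ _;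
    [exists Zero | exists Succ | exists Fst | exists Snd | exists Oracle] => //.
have ek k : e - 5 = 4 * k + (e - 5) %% 4 -> k = (e - 5) %/ 4 by lia.
set k := (e - 5) %/ 4; have lek : k < e by rewrite /k; lia.
have [c hc] := IH _ (leq_ltn_trans (nfst_le k) lek).
have [d hd] := IH _ (leq_ltn_trans (nsnd_le k) lek).
have [f hf] := IH _ lek.
have : (e - 5) %% 4 < 4 by rewrite ltn_mod.
have eE : e = 5 + (e - 5) %% 4 + 4 * k by rewrite /k; lia.
case: ((e - 5) %% 4) eE => [|[|[|[|//]]]] eE _.
- by exists (Pair c d) => /=; rewrite hc hd npairK; lia.
- by exists (Comp c d) => /=; rewrite hc hd npairK; lia.
- by exists (Prec c d) => /=; rewrite hc hd npairK; lia.
- by exists (Mu f) => /=; rewrite hf; lia.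
Qed.

Lemma godel_inj : injective godel.
Proof.
elim=> [||||| f IHf g IHg | f IHf g IHg | f IHf g IHg | f IHf];
  case=> [||||| f' g' | f' g' | f' g' | f'] //= h; try lia;
  try by rewrite (IHf f') //; lia.
all: have /npair_inj[/IHf-> /IHg-> //] :
  npair (godel f) (godel g) = npair (godel f') (godel g') by lia.
Qed.

Lemma justified_mono T T' e n v : (forall y, lmem y T -> lmem y T') ->
  justified T e n v -> justified T' e n v.
Proof.
move=> TT'.
have bnd e1 n1 v1 : lmem (ent e1 n1 v1) T -> v1 < T' /\ lmem (ent e1 n1 v1) T'.
  move=> /TT' h; split=> //.
  by have [_ _] := ent_ge e1 n1 v1; have := lmem_lt h; lia.
rewrite /justified; do 5 (case=> [?|h]; [by left|right; move: h]).
move=> [k [ke h]]; exists k; split=> //.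
case: h => [[-> [h1 h2]]|[[-> [m [_ [h1 h2]]]]|[[-> h]|[-> [h1 h2]]]]].
- by left; split=> //; split; apply: TT'.
- right; left; split=> //; exists m; split; first by have [] := bnd _ _ _ h1.
  by split; apply: TT'.
- right; right; left; split=> //; case: h => [[n0 h]|[n0 [u [_ [h1 h2]]]]].
    by left; split=> //; apply: TT'.
  right; split=> //; exists u; split; first by have [] := bnd _ _ _ h1.
  by split; apply: TT'.
- right; right; right; split=> //; split; first exact: TT'.
  move=> j /h2[w [_ hw]]; exists w; split; last exact: TT'.
  by have [/ltnW] := bnd _ _ _ hw.
Qed.

Lemma valid_cat s s' : valid (lst s) -> valid (lst s') -> valid (lst (s ++ s')).
Proof.
elim: s => //= y s IH; rewrite -(entK y).
move=> /(valid_cons _ _ _ s)[J /IH vs] vs'.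
rewrite -/(lst (s ++ s')); apply/(valid_cons _ _ _ (s ++ s')); split; last exact: vs.
apply: justified_mono J => z; rewrite !lmem_lst mem_cat => ->; exact.
Qed.

Lemma consist_cat X s s' :
  consist X (lst s) -> consist X (lst s') -> consist X (lst (s ++ s')).
Proof.
rewrite !consistP => h h' n v; rewrite lmem_lst mem_cat => /orP[] /lmem_lst.
  exact: h.
exact: h'.
Qed.

Definition derivable (X : set nat) (s : seq nat) :=
  valid (lst s) /\ consist X (lst s).

Lemma derivable_cat X s s' :
  derivable X s -> derivable X s' -> derivable X (s ++ s').
Proof.
by move=> [v c] [v' c']; split; [exact: valid_cat | exact: consist_cat].
Qed.

Lemma derivable_cons X e n v s : derivable X s -> justified (lst s) e n v ->
  (e = 4 -> v = `[< X n >]) -> derivable X (ent e n v :: s).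
Proof.
move=> [vs /consistP cs] J h; split; first exact/(valid_cons _ _ _ s).
apply/consistP => n' v' /lmem_lst; rewrite inE => /orP[/eqP|/lmem_lst/cs //].
by move=> /ent_inj[e4 -> ->]; apply: h.
Qed.

Lemma derivation_sound X s : derivable X s -> forall c n v,
  ent (godel c) n v \in s -> eval X c n v.
Proof.
elim: s => // y s IH; rewrite -(entK y).
move: (nfst y) (nfst (nsnd y)) (nsnd (nsnd y)) => e n v {y}.
move=> [/(valid_cons _ _ _ s)[J vs] /consistP cs].
have {}IH : forall c n v, lmem (ent (godel c) n v) (lst s) -> eval X c n v.
  move=> c n' v'; rewrite lmem_lst; apply: IH; split=> //.
  by apply/consistP => n1 v1 h; apply: cs; apply/(lmem_cons _ _ (lst s)); right.
move=> c n' v'; rewrite inE => /orP[/eqP|/lmem_lst/IH //].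
move=> /ent_inj[ec -> ->] {n' v'}.
have cs4 : e = 4 -> v = `[< X n >].
  by move=> e4; apply: cs; rewrite -e4; apply/(lmem_cons _ _ (lst s)); left.
move: J; rewrite /justified -ec.
case: c ec => [||||| f g | f g | f g | f] /= ec.
- by case=> [[]|[[]|[[]|[[]|[|[k [? ?]]]]]]] //; lia.
- by case=> [[]|[[]|[[]|[[]|[|[k [? ?]]]]]]] //; lia.
- by case=> [[]|[[]|[[]|[[]|[|[k [? ?]]]]]]] //; lia.
- by case=> [[]|[[]|[[]|[[]|[|[k [? ?]]]]]]] //; lia.
- by move=> _; apply: cs4.
all: do 5 (case; [lia|]); move=> [k [_ h]].
- case: h => [[ek [h1 h2]]|]; last by lia.
  have kE : k = npair (godel f) (godel g) by lia.
  rewrite kE nfstK nsndK in h1 h2.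
  by exists (nfst v), (nsnd v); rewrite npairK; split; auto.
- case: h => [|[[ek [m [_ [h1 h2]]]]|]]; [lia| |lia].
  have kE : k = npair (godel f) (godel g) by lia.
  by rewrite kE nfstK nsndK in h1 h2; exists m; auto.
- case: h => [|[|[[ek h]|]]]; [lia|lia| |lia].
  have kE : k = npair (godel f) (godel g) by lia.
  rewrite kE nfstK nsndK in h.
  case: h => [[-> h]|[n0 [u [_ [h1 h2]]]]]; first exact: IH.
  have := IH (Prec f g) (npair (nfst n) (nsnd n).-1) u.
  rewrite /= nfstK nsndK; case: (nsnd n) n0 h1 h2 => // m _ h1 h2 /(_ h1) hu.
  by exists u => //; apply: IH h2.
- case: h => [|[|[|[ek [h1 h2]]]]]; [lia|lia|lia|].
  have kE : k = godel f by lia.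
  rewrite kE in h1 h2; split; first exact: IH.
  by move=> j /h2[w [_ hw]]; exists w; apply: IH.
Qed.

Lemma derivable_collect X (E : nat -> nat -> Prop) v :
  (forall j, j < v -> exists s, derivable X s /\ exists2 y, y \in s & E j y) ->
  exists s, derivable X s /\ forall j, j < v -> exists2 y, y \in s & E j y.
Proof.
elim: v => [|v IH] h; first by exists [::]; split=> //; split=> // y [].
have [|s [ds hs]] := IH; first by move=> j jv; apply: h; exact: ltnW.
have [s' [ds' [y ys' Ey]]] := h _ (ltnSn v).
exists (s ++ s'); split; first exact: derivable_cat.
move=> j; rewrite ltnS leq_eqVlt => /orP[/eqP ->|/hs[z zs Ez]].
  by exists y => //; rewrite mem_cat ys' orbT.
by exists z => //; rewrite mem_cat zs.
Qed.

Lemma derivation_complete X c n v : eval X c n v ->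
  exists s, derivable X s /\ ent (godel c) n v \in s.
Proof.
have base e n' v' : e <= 4 -> (forall T, justified T e n' v') ->
    (e = 4 -> v' = `[< X n' >]) ->
    exists s, derivable X s /\ ent e n' v' \in s.
  move=> _ J h; exists [:: ent e n' v']; split; last by rewrite inE.
  by apply: derivable_cons => //; split=> // y [].
have head e n' v' s : derivable X s -> justified (lst s) e n' v' -> 4 < e ->
    exists s, derivable X s /\ ent e n' v' \in s.
  move=> ds J e4; exists (ent e n' v' :: s); split; last by rewrite inE eqxx.
  by apply: derivable_cons => // ee; rewrite ee in e4.
elim: c n v => [||||| f IHf g IHg | f IHf g IHg | f IHf g IHg | f IHf] n v.
- by move=> /= ->; apply: base => // T; left.
- by move=> /= ->; apply: base => // T; right; left.
- by move=> /= ->; apply: base => // T; do 2 right; left.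
- by move=> /= ->; apply: base => // T; do 3 right; left.
- by move=> /= ->; apply: base => // T; do 4 right; left.
- move=> [x [y [/IHf[s [ds fs]] /IHg[s' [ds' gs]] ->]]].
  apply: (head _ _ _ (s ++ s')) => //; first exact: derivable_cat.
  do 5 right; exists (npair (godel f) (godel g)); split; first by rewrite /=; lia.
  left; split=> //; rewrite !nfstK !nsndK !lmem_lst !mem_cat.
  by rewrite fs gs orbT.
- move=> [m /IHg[s' [ds' gs]] /IHf[s [ds fs]]].
  apply: (head _ _ _ (s ++ s')) => //; first exact: derivable_cat.
  do 5 right; exists (npair (godel f) (godel g)); split; first by rewrite /=; lia.
  right; left; split=> //; exists m.
  have h : lmem (ent (godel g) n m) (lst (s ++ s')).
    by rewrite lmem_lst mem_cat gs orbT.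
  split; first by have := lmem_lt h; have [_ _] := ent_ge (godel g) n m; lia.
  by rewrite nfstK nsndK; split=> //; rewrite lmem_lst mem_cat fs.
- rewrite -(npairK n) /= nfstK nsndK; move: (nfst n) (nsnd n) => a k {n}.
  elim: k v => [|k IHk] v.
    move=> /IHf[s [ds fs]].
    apply: (head _ _ _ s) => //.
    do 5 right; exists (npair (godel f) (godel g)); split; first by lia.
    do 2 right; left; split=> //; left.
    by rewrite !nfstK !nsndK lmem_lst.
  move=> [u /IHk[s' [ds' hs]] /IHg[s [ds gs]]].
  apply: (head _ _ _ (s ++ s')) => //; first exact: derivable_cat.
  do 5 right; exists (npair (godel f) (godel g)); split; first by lia.
  do 2 right; left; split=> //; right; rewrite !nfstK !nsndK /=; split=> //.
  exists u.
  have h : lmem (ent (7 + 4 * npair (godel f) (godel g)) (npair a k) u)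
      (lst (s ++ s')).
    by rewrite lmem_lst mem_cat hs orbT.
  split.
    have := lmem_lt h.
    by have [_ _] := ent_ge (7 + 4 * npair (godel f) (godel g)) (npair a k) u; lia.
  by split=> //; rewrite lmem_lst mem_cat gs.
- move=> [/IHf[s [ds fs]] hv].
  have [|s' [ds' hs']] := @derivable_collect X
      (fun j y => exists w, y = ent (godel f) (npair n j) w.+1) v.
    move=> j /hv[w /IHf[s' [ds' hs']]]; exists s'; split=> //.
    by exists (ent (godel f) (npair n j) w.+1) => //; exists w.
  apply: (head _ _ _ (s ++ s')) => //; first exact: derivable_cat.
  do 5 right; exists (godel f); split; first by rewrite /=; lia.
  do 3 right; split=> //; split; first by rewrite lmem_lst mem_cat fs.
  move=> j /hs'[y ys [w yE]]; exists w.
  have h : lmem y (lst (s ++ s')) by rewrite lmem_lst mem_cat ys orbT.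
  rewrite -yE; split=> //; have := lmem_lt h; rewrite yE.
  by have [_ _] := ent_ge (godel f) (npair n j) w.+1; lia.
Qed.

Definition facts (X : set nat) : set nat :=
  [set y | exists L, [/\ valid L, lmem y L & consist X L]].

Lemma factsP X c n v : facts X (ent (godel c) n v) <-> eval X c n v.
Proof.
split=> [[L [vL mL cL]]|/derivation_complete[s [[vs cs] ms]]].
  have [s sL] := lst_surj L; subst L.
  by apply: (@derivation_sound X s) => //; rewrite -lmem_lst.
by exists (lst s); split=> //; rewrite lmem_lst.
Qed.

Lemma facts_det X e n v w :
  facts X (ent e n v) -> facts X (ent e n w) -> v = w.
Proof.
have [c <-] := godel_surj e; rewrite !factsP; exact: eval_det.
Qed.

(** * The jump *)

Definition const_code (n : nat) : code := iter n (Comp Succ) Zero.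

Lemma eval_const X n x v : eval X (const_code n) x v <-> v = n.
Proof.
elim: n v => //= n IH v; split=> [[m /IH -> ->] //|->].
by exists n => //; apply/IH.
Qed.

Lemma sigma1_jump (P : nat -> nat -> Prop) :
  recp set0 (fun p => P (nfst p) (nsnd p)) ->
  recp (jump set0) (fun n => exists k, P n k).
Proof.
move=> rP; have [c hc] := recp_not rP.
have rg : recf (jump set0) (fun n => godel (Comp (Mu c) (const_code n))).
  apply: (@recf_ext _ (fun n =>
      6 + 4 * npair (godel (Mu c)) (iter n (fun g => 6 + 4 * npair 1 g) 0))).
    by move=> n /=; do 2 f_equal; f_equal; elim: n => //= n <-.
  by rec.
apply: recp_iff (recp_comp (@recp_oracle (jump set0)) rg) => n.
have hc' k : eval set0 c (npair n k) `[< ~ P n k >].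
  by have := hc (npair n k); rewrite nfstK nsndK.
split.
  move=> [d [/godel_inj -> [v [m /eval_const -> [hv _]]]]].
  exists v; have := eval_det hv (hc' v); case: asboolP => // /contrapT Pv _.
  exact: Pv.
move=> [k Pk]; exists (Comp (Mu c) (const_code n)); split=> //.
have ex : exists k, `[< P n k >] by exists k; apply/asboolP.
exists (ex_minn ex), n; first exact/eval_const.
case: ex_minnP => m /asboolP Pm min; split.
  by have := hc' m; case: asboolP.
move=> j jm; exists 0; have := hc' j; case: asboolP => // /contrapT /asboolP /min.
by rewrite leqNgt jm.
Qed.

Lemma pi1_jump (P : nat -> nat -> Prop) :
  recp set0 (fun p => P (nfst p) (nsnd p)) ->
  recp (jump set0) (fun n => forall k, P n k).
Proof.
move=> rP; apply: (@recp_iff _ (fun n => ~ exists k, ~ P n k)).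
  move=> n; split=> [h k|h [k]]; last exact.
  by apply: contrapT => nk; apply: h; exists k.
by apply/recp_not/(@sigma1_jump (fun n k => ~ P n k)); rec.
Qed.

Lemma Delta02_jump A : Delta02 A -> recp (jump set0) A.
Proof.
move=> [[R [cR hR]] [R' [cR' hR']]].
have rR : recp set0 R by [].
have rR' : recp set0 R' by [].
have r1 : recp (jump set0) (fun p => forall z, R (npair (nfst p) (npair (nsnd p) z))).
  by apply: (@pi1_jump (fun p z => R (npair (nfst p) (npair (nsnd p) z)))); rec.
have r2 : recp (jump set0) (fun p => forall z, R' (npair (nfst p) (npair (nsnd p) z))).
  by apply: (@pi1_jump (fun p z => R' (npair (nfst p) (npair (nsnd p) z)))); rec.
have [||f [rf hf]] := @recf_choose (jump set0) (fun x y =>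
  (forall z, R (npair x (npair y z))) \/ (forall z, R' (npair x (npair y z)))).
- exact: recp_or.
- move=> x; have [/hR[y hy]|/hR'[y hy]] := EM (A x); exists y; [by left|by right].
apply: (@recp_iff _ (fun x => forall z, R (npair x (npair (f x) z)))).
  move=> x; split=> [h|Ax]; first by apply/hR; exists (f x).
  by case: (hf x) => // h; have : (~` A) x by apply/hR'; exists (f x).
have := recp_comp r1 (recf_npair (recf_id _) rf).
by apply: recp_iff => x; rewrite nfstK nsndK.
Qed.

Definition halting (n w : nat) : Prop :=
  valid w /\ consist set0 w /\ exists v, v < w /\ lmem (ent n n v) w.

Lemma recp_halting X : recp X (fun p => halting (nfst p) (nsnd p)).
Proof.
have h : recp X (fun p => consist set0 (nsnd p)).
  exact: (@recp_consist X (fun _ _ => False) nsnd (recp_const _ _)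
    (recf_nsnd (recf_id _))).
by rewrite /halting; rec.
Qed.

Lemma haltingP n : jump set0 n <-> exists w, halting n w.
Proof.
split=> [[c [<- [v /factsP[L [vL mL cL]]]]]|[w [vw [cw [v [_ mv]]]]]].
  exists L; split=> //; split=> //; exists v; split=> //.
  by have := lmem_lt mL; have [_ _] := ent_ge (godel c) (godel c) v; lia.
have [c cn] := godel_surj n; exists c; split=> //; exists v.
by rewrite -[X in eval _ _ X]cn; apply/factsP; rewrite cn; exists w.
Qed.

Lemma halting_bound b :
  exists W, forall n, n < b -> jump set0 n -> exists w, w < W /\ halting n w.
Proof.
elim: b => [|b [W hW]]; first by exists 0.
have [/haltingP[w hw]|nj] := EM (jump set0 b).
  exists (maxn W w.+1) => n; rewrite ltnS leq_eqVlt => /orP[/eqP -> _|nb jn].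
    by exists w; split=> //; lia.
  by have [w' [w'W hw']] := hW _ nb jn; exists w'; split=> //; lia.
by exists W => n; rewrite ltnS leq_eqVlt => /orP[/eqP ->|/hW].
Qed.

Lemma jump_Sigma02 (P : set nat) : recp (jump set0) P -> Sigma02 P.
Proof.
move=> [c hc].
pose answers (L W z y : nat) : Prop :=
  (nsnd (nsnd y) = 1 /\ exists w, w < W /\ halting (nfst (nsnd y)) w) \/
  (nsnd (nsnd y) = 0 /\ ~ halting (nfst (nsnd y)) z).
pose phi (x L W z : nat) := valid L /\ lmem (ent (godel c) x 1) L /\
  forall y, y < L -> lmem y L -> nfst y = 4 -> answers L W z y.
exists [set p | phi (nfst p) (nfst (nfst (nsnd p))) (nsnd (nfst (nsnd p)))
  (nsnd (nsnd p))]; split.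
  have := recp_halting set0; rewrite /computable /turing_le -/(recp _ _).
  by rewrite /phi /answers /= => rh; rec.
move=> x.
have -> : P x <-> eval (jump set0) c x 1.
  have := hc x; case: asboolP => Px h; split=> // h'.
  by have := eval_det h h'.
split.
  move=> /factsP[L [vL mL /consistP cL]].
  have [W hW] := halting_bound L.
  exists (npair L W) => z; rewrite /= !(nfstK, nsndK); split=> //; split=> //.
  move=> y yL my y4; move: my yL; rewrite -(entK y) y4 => my yL.
  rewrite /answers /ent !(nfstK, nsndK); have := cL _ _ my.
  have nL : nfst (nsnd y) < L by have [] := ent_ge 4 (nfst (nsnd y)) (nsnd (nsnd y)); lia.
  case: asboolP => [j ->|nj ->]; [left|right]; split=> //; first exact: hW.
  by move=> hz; apply: nj; apply/haltingP; exists z.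
move=> [y hy]; have [vL [mL _]] := hy 0; apply/factsP.
exists (nfst y); rewrite !(nfstK, nsndK) in vL mL; split=> //.
move=> q qL mq q4; have [//|] := EM (jump set0 (nfst (nsnd q))).
  move=> /[dup] j /haltingP[z hz]; rewrite asboolT //.
  have [_ [_ /(_ q)]] := hy z; rewrite !(nfstK, nsndK) => /(_ qL mq q4).
  by case=> [[-> _]|[_]].
move=> nj; rewrite asboolF //.
have [_ [_ /(_ q)]] := hy 0; rewrite !(nfstK, nsndK) => /(_ qL mq q4).
case=> [[_ [w [_ hw]]]|[-> _]] //; case: nj; apply/haltingP; by exists w.
Qed.

Lemma string_code_surj n : exists s, string_code s = n.
Proof.
elim/ltn_ind: n => -[|n] IH; first by exists [::].
have [|s hs] := IH n./2; first by lia.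
exists (odd n :: s); rewrite /= -/(string_code s) hs.
by have := odd_double_half n; lia.
Qed.

Lemma two_generic_dec (G : set nat) (P : set nat) : two_generic G ->
  recp (jump set0) P ->
  exists s, initial_segment s G /\
    (P (string_code s) \/ forall t, prefix s t -> ~ P (string_code t)).
Proof.
move=> hG rP; apply: (hG [set s | P (string_code s)]).
rewrite /Sigma02_strings.
have -> : string_code @` [set s | P (string_code s)] = P.
  apply/seteqP; split=> [n [s Ps <-] //|n Pn].
  by have [s sn] := string_code_surj n; exists s => //=; rewrite sn.
exact: jump_Sigma02.
Qed.

(** * Compactness of Cantor space *)

Definition lset (l : nat) : set nat := [set n | lmem n l].

Definition full_lst (u : nat) : nat := prim lcons 0 u.

Lemma lcons_mono x l l' : l <= l' -> lcons x l <= lcons x l'.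
Proof. by move=> ll'; rewrite ltnS npair_mono. Qed.

Lemma leq_lcons x l : l <= lcons x l.
Proof. by rewrite /lcons ltnW // ltnS leq_npair2. Qed.

Lemma initial_lst (M : set nat) u :
  exists z, z <= full_lst u /\ forall n, lset z n <-> n < u /\ M n.
Proof.
elim: u => [|u [z [zu hz]]]; first by exists 0; split=> // n; split=> [/lmem0|[]].
have step n : n < u.+1 <-> n = u \/ n < u by lia.
have [Mu|nMu] := EM (M u).
  exists (lcons u z); split; first exact: lcons_mono.
  move=> n; have := hz n; rewrite /lset /= lmem_cons step => ->.
  by split=> [[->|[]]|[[->|]]]; auto.
exists z; split; first exact: leq_trans (leq_lcons _ _).
move=> n; rewrite hz step; split=> [[]|[[->|]]]; by auto.
Qed.

Section Compactness.
Variable Q : nat -> set nat -> Prop.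
Hypothesis Q_local : forall w (M M' : set nat),
  (forall n, n <= w -> M n <-> M' n) -> Q w M -> Q w M'.

Let extendible k (M : set nat) := forall m, exists M' : set nat,
  (forall n, n < k -> M' n <-> M n) /\ forall w, w < m -> Q w M'.

Let Fixpoint path k : set nat :=
  if k is k'.+1 then
    if `[< extendible k (path k' `|` [set k']) >] then path k' `|` [set k']
    else path k'
  else set0.

Let path_lt k n : path k n -> n < k.
Proof.
elim: k => //= k IH; case: ifP => _; last by move/IH; exact: ltnW.
by case=> [/IH/ltnW //|->].
Qed.

Let path_stable k k' n : n < k -> k <= k' -> path k' n <-> path k n.
Proof.
move=> nk; elim: k' => [|k' IH]; first by case: k nk.
rewrite leq_eqVlt => /orP[/eqP <- //|]; rewrite ltnS => kk' /=.
case: ifP => _; last exact: IH.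
rewrite -IH //; split=> [[//|] /= nE|]; [lia|by left].
Qed.

Lemma compactness :
  (forall m, exists M, forall w, w < m -> Q w M) -> exists M, forall w, Q w M.
Proof.
move=> h.
have ext k : extendible k (path k).
  elim: k => [|k IH] m; first by have [M hM] := h m; exists M.
  rewrite /path -/path; case: asboolP => [ext|]; first exact: ext.
  move=> /existsNP[m0 hm0]; have [M' [M'k M'Q]] := IH (maxn m m0).
  exists M'; split; last by move=> w wm; apply: M'Q; rewrite leq_max wm.
  move=> n; rewrite ltnS leq_eqVlt => /orP[/eqP ->|nk]; last exact: M'k.
  split=> [M'n|/path_lt]; last by rewrite ltnn.
  case: hm0; exists M'; split; last first.
    by move=> w wm; apply: M'Q; rewrite leq_max wm orbT.
  move=> i; rewrite ltnS leq_eqVlt => /orP[/eqP ->|ik]; first by split=> // _; right.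
  by rewrite M'k //; split=> [|[//|iE]]; [left | rewrite /= in iE; lia].
exists [set n | path n.+1 n] => w.
have [M' [M'w /(_ w (ltnSn w)) Qw]] := ext w.+1 w.+1.
apply: Q_local Qw => n nw; rewrite M'w //.
exact: path_stable.
Qed.

Lemma compactness_lst : (exists M, forall w, Q w M) <->
  forall m, exists z, z < (full_lst m).+1 /\ forall w, w < m -> Q w (lset z).
Proof.
split=> [[M QM] m|h]; last first.
  by apply: compactness => m; have [z [_ hz]] := h m; exists (lset z).
have [z [zm hz]] := initial_lst M m; exists z; split=> // w wm.
apply: Q_local (QM w) => n nw; rewrite hz.
by split=> [|[]//]; split=> //; exact: leq_ltn_trans wm.
Qed.

End Compactness.

(** * Reservoirs and splittings *)

(* A state consists of a stack [l], of finite parts [D0] of [A] and [D1] of its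
   complement, and of a bound [b] below which these are final. A stack is [0] or
   [push st fl j], where [st] is the state in which it was built (so that the
   rest of the stack is [stack st]) and [j.+1] is its height; [fl] says whether
   the reservoir is cut down to the column of [st] (0), to its complement (1),
   or not at all (2). *)
Definition state (l D0 D1 b : nat) : nat := npair l (npair (npair D0 D1) b).
Definition stack (st : nat) : nat := nfst st.
Definition part0 (st : nat) : nat := nfst (nfst (nsnd st)).
Definition part1 (st : nat) : nat := nsnd (nfst (nsnd st)).
Definition bound (st : nat) : nat := nsnd (nsnd st).

Definition push (st fl : nat) (j : nat) : nat := (npair (npair st fl) j).+1.
Definition origin (l : nat) : nat := nfst (nfst l.-1).
Definition flag (l : nat) : nat := nsnd (nfst l.-1).
Definition depth (l : nat) : nat := if `[< l = 0 >] then 0 else (nsnd l.-1).+1.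
Definition below (l : nat) : nat := stack (origin l).

Lemma stateK l D0 D1 b : [/\ stack (state l D0 D1 b) = l,
  part0 (state l D0 D1 b) = D0, part1 (state l D0 D1 b) = D1
  & bound (state l D0 D1 b) = b].
Proof. by rewrite /stack /part0 /part1 /bound /state !(nfstK, nsndK). Qed.

Lemma pushK st fl j : [/\ origin (push st fl j) = st, flag (push st fl j) = fl,
  depth (push st fl j) = j.+1 & below (push st fl j) = stack st].
Proof.
by rewrite /below /origin /flag /depth /push asboolF //= !(nfstK, nsndK).
Qed.

Lemma below0 : below 0 = 0.
Proof.
by have := nfst_le 0; rewrite /below /stack /origin leqn0 => /eqP e; rewrite !e.
Qed.

Lemma origin_lt l : l <> 0 -> origin l < l.
Proof.
case: l => // l _; rewrite /origin /= ltnS.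
exact: leq_trans (nfst_le _) (nfst_le _).
Qed.

Lemma below_lt l : l <> 0 -> below l < l.
Proof. by move=> /origin_lt; apply: leq_ltn_trans; exact: nfst_le. Qed.

Lemma iter_below_le t l : iter t below l <= l.
Proof.
elim: t => //= t IH; apply: leq_trans IH; move: (iter t below l) => s.
by have [->|/eqP/below_lt/ltnW //] := eqVneq s 0; rewrite below0.
Qed.

Lemma iter_below_ge t l : l <= t -> iter t below l = 0.
Proof.
elim: t l => [|t IH] l; first by rewrite leqn0 => /eqP.
move=> lt; rewrite iterSr; apply: IH; have [->|/eqP/below_lt] := eqVneq l 0.
  by rewrite below0.
by lia.
Qed.

Section RecState.
Variables (X : set nat) (f g h k : nat -> nat).
Hypotheses (rf : recf X f) (rg : recf X g) (rh : recf X h) (rk : recf X k).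

Lemma recf_state : recf X (fun n => state (f n) (g n) (h n) (k n)).
Proof. by rewrite /state; rec. Qed.

Lemma recf_stack : recf X (fun n => stack (f n)).
Proof. by rewrite /stack; rec. Qed.

Lemma recf_part0 : recf X (fun n => part0 (f n)).
Proof. by rewrite /part0; rec. Qed.

Lemma recf_part1 : recf X (fun n => part1 (f n)).
Proof. by rewrite /part1; rec. Qed.

Lemma recf_bound : recf X (fun n => bound (f n)).
Proof. by rewrite /bound; rec. Qed.

Lemma recf_push : recf X (fun n => push (f n) (g n) (h n)).
Proof. by rewrite /push; rec. Qed.

Lemma recf_origin : recf X (fun n => origin (f n)).
Proof. by rewrite /origin; rec. Qed.

Lemma recf_flag : recf X (fun n => flag (f n)).
Proof. by rewrite /flag; rec. Qed.

Lemma recf_depth : recf X (fun n => depth (f n)).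
Proof. by rewrite /depth; rec. Qed.

Lemma recf_below : recf X (fun n => below (f n)).
Proof. by rewrite /below /stack /origin; rec. Qed.
End RecState.
Ltac rec_state ::= first
  [ simple apply recf_state | simple apply recf_stack
  | simple apply recf_part0 | simple apply recf_part1
  | simple apply recf_bound | simple apply recf_push
  | simple apply recf_origin | simple apply recf_flag
  | simple apply recf_depth | simple apply recf_below ].

Definition side (M : set nat) (l x : nat) : Prop :=
  (flag l = 0 -> M (npair (origin l) x)) /\
  (flag l = 1 -> ~ M (npair (origin l) x)).

Definition reservoir (M : set nat) (l : nat) : set nat :=
  [set x | forall t, t < l -> iter t below l <> 0 -> side M (iter t below l) x].

Lemma reservoirS M l x : l <> 0 ->
  reservoir M l x <-> side M l x /\ reservoir M (below l) x.
Proof.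
have bnd s t : iter t below s <> 0 -> t < s.
  by move=> h; rewrite ltnNge; apply/negP => /iter_below_ge.
move=> l0; split=> [h|[s0 h] [|t] _ t0 //].
  split; first by apply: (h 0) => //; rewrite lt0n; apply/eqP.
  move=> t _ t0; have := h t.+1; rewrite iterSr; apply => //.
  by apply: bnd; rewrite iterSr.
rewrite iterSr in t0 *; apply: h => //; exact: bnd.
Qed.

Lemma reservoir_local (M M' : set nat) l x :
  (forall a, a < l -> M (npair a x) <-> M' (npair a x)) ->
  reservoir M l x -> reservoir M' l x.
Proof.
move=> MM' h t tl t0; have [h0 h1] := h t tl t0.
have e : M (npair (origin (iter t below l)) x) <->
         M' (npair (origin (iter t below l)) x).
  by apply: MM'; apply: leq_trans (origin_lt t0) (iter_below_le _ _).
by split=> ?; rewrite -e; auto.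
Qed.

Lemma recp_reservoir X (Y : nat -> nat -> Prop) f g :
  recp X (fun p => Y (nfst p) (nsnd p)) -> recf X f -> recf X g ->
  recp X (fun n => reservoir (Y n) (f n) (g n)).
Proof. by move=> rY rf rg; rewrite /reservoir /side /=; rec. Qed.

(* The oracle answers in [L] are those of [D] together with a finite subset of
   [Z] of elements [>= b]. *)
Definition compatible (D b : nat) (Z : set nat) (L : nat) : Prop :=
  consist (fun n => lmem n D \/ (b <= n /\ lmem (ent 4 n 1) L)) L /\
  forall n, n < L -> b <= n -> lmem (ent 4 n 1) L -> Z n.

Definition converges (e D b : nat) (Z : set nat) (L x v : nat) : Prop :=
  valid L /\ lmem (ent e x v) L /\ compatible D b Z L.

Definition splits (e D b : nat) (Z : set nat) (w : nat) : Prop :=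
  exists L, L < w /\ exists L', L' < w /\ exists x, x < w /\ exists v, v < w /\
  exists v', v' < w /\
  (v <> v' /\ converges e D b Z L x v /\ converges e D b Z L' x v').

Lemma recp_converges X (Y : nat -> nat -> Prop) fe fD fb fL fx fv :
  recp X (fun p => Y (nfst p) (nsnd p)) ->
  recf X fe -> recf X fD -> recf X fb -> recf X fL -> recf X fx -> recf X fv ->
  recp X (fun n => converges (fe n) (fD n) (fb n) (Y n) (fL n) (fx n) (fv n)).
Proof.
move=> rY re rD rb rL rx rv; rewrite /converges /compatible.
apply: recp_and; first by rec.
apply: recp_and; first by rec.
apply: recp_and; last by rec.
apply: (@recp_consist X (fun m n => lmem n (fD m) \/
  (fb m <= n /\ lmem (ent 4 n 1) (fL m)))); by rec.
Qed.

Lemma recp_splits X (Y : nat -> nat -> Prop) fe fD fb fw :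
  recp X (fun p => Y (nfst p) (nsnd p)) ->
  recf X fe -> recf X fD -> recf X fb -> recf X fw ->
  recp X (fun n => splits (fe n) (fD n) (fb n) (Y n) (fw n)).
Proof.
move=> rY re rD rb rw; rewrite /splits.
do 5 (apply: recp_bex; first by rec); cbv beta.
by apply: recp_and; [rec|apply: recp_and;
  apply: (@recp_converges X (fun n => Y (nfst (nfst (nfst (nfst (nfst n))))))); rec].
Qed.

Lemma converges_local e D b (Z Z' : set nat) L x v :
  (forall n, n < L -> Z n -> Z' n) ->
  converges e D b Z L x v -> converges e D b Z' L x v.
Proof.
by move=> ZZ' [vL [mL [cL hZ]]]; split=> //; split=> //; split; auto.
Qed.

Lemma splits_local e D b (Z Z' : set nat) w :
  (forall n, n < w -> Z n -> Z' n) ->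
  splits e D b Z w -> splits e D b Z' w.
Proof.
move=> ZZ' [L [Lw [L' [Lw' [x [xw [v [vw [v' [vw' [vv' [h h']]]]]]]]]]]].
exists L; split=> //; exists L'; split=> //; exists x; split=> //.
exists v; split=> //; exists v'; split=> //; split=> //.
by split; [move: h|move: h']; apply: converges_local => n nL; apply: ZZ'; lia.
Qed.

Lemma splits_sub e D b (Z Z' : set nat) w :
  Z `<=` Z' -> splits e D b Z w -> splits e D b Z' w.
Proof. by move=> ZZ'; apply: splits_local => n _; exact: ZZ'. Qed.

Lemma converges_splits e D b Z L L' x v v' :
  converges e D b Z L x v -> converges e D b Z L' x v' -> v <> v' ->
  exists w, splits e D b Z w.
Proof.
move=> h h' vv'; exists (L + L' + x + v + v').+1.
exists L; split; first by lia.
exists L'; split; first by lia.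
exists x; split; first by lia.
exists v; split; first by lia.
by exists v'; split; first by lia.
Qed.

Lemma converges_facts e D b Z L x v : converges e D b Z L x v ->
  facts (fun n => lmem n D \/ (b <= n /\ lmem (ent 4 n 1) L)) (ent e x v).
Proof. by move=> [vL [mL [cL _]]]; exists L. Qed.

Lemma facts_converges (Y : set nat) e D b (Z : set nat) x v :
  (forall n, lmem n D -> Y n) -> (forall n, Y n -> n < b -> lmem n D) ->
  (forall n, Y n -> b <= n -> Z n) ->
  facts Y (ent e x v) -> exists L, converges e D b Z L x v.
Proof.
move=> DY YD YZ [L [vL mL /consistP cL]]; exists L; split=> //; split=> //.
have Y1 n : lmem (ent 4 n 1) L -> Y n by move=> /cL; case: asboolP.
split; last by move=> n _ bn /Y1 Yn; exact: YZ.
apply/consistP => n u h; have uE := cL _ _ h; rewrite uE; congr nat_of_bool.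
apply: asbool_equiv_eq; split=> [Yn|[/DY //|[_ /Y1 //]]].
have [nb|bn] := ltnP n b; [by left; exact: YD | right; split=> //].
by move: h; rewrite uE asboolT.
Qed.

(* [w] refutes that [Z] splits the reservoir [X] of the state [a] into a part
   [X `&` Z] on which the first functional of the pair [depth (stack a)] is
   constant over [part0 a] and a part [X `\` Z] on which the second one is
   constant over [part1 a]. *)
Definition refutes (X : set nat) (a : nat) (Z : set nat) (w : nat) : Prop :=
  splits (nfst (depth (stack a))) (part0 a) (bound a) (X `&` Z) w \/
  splits (nsnd (depth (stack a))) (part1 a) (bound a) (X `\` Z) w.

Lemma refutes_local (X X' : set nat) a (Z Z' : set nat) w :
  (forall n, n < w -> X n <-> X' n) -> (forall n, n < w -> Z n <-> Z' n) ->
  refutes X a Z w -> refutes X' a Z' w.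
Proof.
move=> XX' ZZ' [h|h]; [left|right]; move: h; apply: splits_local => n nw [Xn Zn].
  by split; [apply/XX' | apply/ZZ'].
by split; [apply/XX' | move=> /ZZ' h; apply: Zn; apply: h].
Qed.

Lemma recp_refutes X (Y Z : nat -> nat -> Prop) fa fw :
  recp X (fun p => Y (nfst p) (nsnd p)) ->
  recp X (fun p => Z (nfst p) (nsnd p)) ->
  recf X fa -> recf X fw ->
  recp X (fun n => refutes (Y n) (fa n) (Z n) (fw n)).
Proof.
move=> rY rZ ra rw; rewrite /refutes; apply: recp_or.
  by apply: (@recp_splits X (fun n m => Y n m /\ Z n m)); rec.
by apply: (@recp_splits X (fun n m => Y n m /\ ~ Z n m)); rec.
Qed.

Definition column (M : set nat) (a : nat) : set nat := [set x | M (npair a x)].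

(* For [M] in this closed class, column [a] is a solution to the splitting
   problem of the state [a] whenever there is one. *)
Definition scott (u : nat) (M : set nat) : Prop :=
  let a := nfst u in let n := nfst (nsnd u) in let z := nsnd (nsnd u) in
  (forall w, w < n -> ~ refutes (reservoir M (stack a)) a (lset z) w) ->
  forall w, w < n -> ~ refutes (reservoir M (stack a)) a (column M a) w.

Lemma scott_local u (M M' : set nat) : (forall n, n <= u -> M n <-> M' n) ->
  scott u M -> scott u M'.
Proof.
rewrite /scott -{1}(npairK u) -(npairK (nsnd u)).
move: (nfst u) (nfst (nsnd u)) (nsnd (nsnd u)) => a n z {u} MM'.
rewrite !(nfstK, nsndK).
have agree a' x : a' <= a -> x < n -> M (npair a' x) <-> M' (npair a' x).
  move=> aa' xn; apply: MM'; apply: npair_mono => //.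
  exact: leq_trans (ltnW xn) (leq_npair1 _ _).
have res x : x < n -> reservoir M (stack a) x <-> reservoir M' (stack a) x.
  move=> xn; have sa : stack a <= a by exact: nfst_le.
  split; apply: reservoir_local => a' aa'; [|apply: iff_sym];
    by apply: agree => //; exact: leq_trans (ltnW aa') sa.
move=> h h1 w wn h2; apply: (h _ w wn).
  move=> w' wn' h3; apply: (h1 w' wn'); move: h3.
  by apply: refutes_local => // x xw; apply: res; lia.
move: h2; apply: refutes_local => x xw; apply: iff_sym.
  by apply: res; lia.
by apply: agree => //; lia.
Qed.

Lemma recp_scott X (Y : nat -> nat -> Prop) f :
  recp X (fun p => Y (nfst p) (nsnd p)) -> recf X f ->
  recp X (fun n => scott (f n) (Y n)).
Proof.
move=> rY rf; rewrite /scott /column /lset.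
have rR : recp X (fun p => (fun m n => reservoir (Y (nfst m))
    (stack (nfst (f (nfst m)))) n) (nfst p) (nsnd p)).
  by apply: (@recp_reservoir X (fun n => Y (nfst (nfst n)))); rec.
apply: recp_imp; apply: recp_ball; try (by rec); apply: recp_not.
  by apply: (recp_refutes rR
    (Z := fun m n => lmem n (nsnd (nsnd (f (nfst m)))))); rec.
by apply: (recp_refutes rR
  (Z := fun m n => Y (nfst m) (npair (nfst (f (nfst m))) n))); rec.
Qed.

Lemma refutes_solution X a : exists Z : set nat, forall n z,
  (forall w, w < n -> ~ refutes X a (lset z) w) ->
  forall w, w < n -> ~ refutes X a Z w.
Proof.
have [h|/existsNP[n0 hn0]] :=
    EM (forall n, exists z, forall w, w < n -> ~ refutes X a (lset z) w).
  have [|m|Z hZ] := @compactness (fun w Z => ~ refutes X a Z w).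
  - move=> w M M' MM' nM hM; apply: nM; move: hM.
    by apply: refutes_local => // n nw; apply: iff_sym; apply: MM'; exact: ltnW.
  - by have [z hz] := h m; exists (lset z).
  - by exists Z => n z _ w _.
have ex : exists n, `[< ~ exists z, forall w, w < n -> ~ refutes X a (lset z) w >].
  by exists n0; apply/asboolP.
case: (ex_minnP ex) => -[|n1] /asboolP hn1 min; first by case: hn1; exists 0.
have [z hz] : exists z, forall w, w < n1 -> ~ refutes X a (lset z) w.
  by apply: contrapT => /asboolP /min; rewrite ltnn.
exists (lset z) => n z' h w wn; apply: hz.
have [nn1|n1n] := leqP n n1; first exact: leq_trans wn nn1.
by case: hn1; exists z' => w' wn'; apply: h; lia.
Qed.

Lemma scott_inhabited : exists M, forall u, scott u M.
Proof.
pose sol X a : set nat := projT1 (cid (refutes_solution X a)).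
have solP X a := projT2 (cid (refutes_solution X a)).
pose fix stage (k : nat) : set nat := if k is k'.+1 then
  stage k' `|` [set n | nfst n = k' /\ sol (reservoir (stage k') (stack k')) k' (nsnd n)]
  else set0.
have stage_lt k n : stage k n -> nfst n < k.
  by elim: k => //= k IH [/IH/ltnW|[->]].
have stage_stable k k' n : nfst n < k -> k <= k' -> stage k' n <-> stage k n.
  move=> nk; elim: k' => [|k' IH]; first by case: k nk.
  rewrite leq_eqVlt => /orP[/eqP <- //|]; rewrite ltnS => kk'.
  rewrite -IH //=; split=> [[//|[]]|]; [lia|by left].
exists [set n | stage (nfst n).+1 n] => u; rewrite /scott /=.
move: (nfst u) (nfst (nsnd u)) (nsnd (nsnd u)) => a n z {u}.
set M := [set n | _].
have res x : reservoir (stage a) (stack a) x <-> reservoir M (stack a) x.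
  have sa : stack a <= a by exact: nfst_le.
  have agree a' : a' < stack a -> stage a (npair a' x) <-> M (npair a' x).
    move=> aa'; apply: (stage_stable (nfst (npair a' x)).+1 a) => //.
    by rewrite nfstK; exact: leq_trans aa' sa.
  by split; apply: reservoir_local => a' aa'; [|apply: iff_sym]; exact: agree.
have col x : sol (reservoir (stage a) (stack a)) a x <-> column M a x.
  rewrite /column /M /= nfstK nsndK; split=> [|[/stage_lt|[]//]]; first by right.
  by rewrite nfstK ltnn.
move=> h w wn hw; apply: (solP (reservoir (stage a) (stack a)) a n z _ w wn).
  move=> w' wn' h'; apply: (h w' wn'); move: h'.
  by apply: refutes_local => // x _; exact: res.
by move: hw; apply: refutes_local => x _; apply: iff_sym; [exact: res|exact: col].
Qed.

(** * A low set avoiding the cone above C *)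

Definition derives (M : set nat) (u y : nat) : Prop :=
  valid u /\ lmem y u /\ consist M u.

Lemma consist_local (M M' : set nat) u :
  (forall n, n <= u -> M n <-> M' n) -> consist M u -> consist M' u.
Proof.
move=> MM' /consistP cM; apply/consistP => n v h; rewrite (cM _ _ h).
congr nat_of_bool; apply/asbool_equiv_eq/MM'.
by have [_ ? _] := ent_ge 4 n v; have := lmem_lt h; lia.
Qed.

Lemma factsE M y : facts M y <-> exists u, derives M u y.
Proof. by split=> [[L []]|[L [? [? ?]]]]; exists L. Qed.

(* [forall u, avoids L u M] defines the Pi01 class of the [M] in the class
   [scott] at which none of the facts in the list [L] hold; [avoids L u M]
   depends only on [M] up to [u]. *)
Definition avoids (L u : nat) (M : set nat) : Prop :=
  scott u M /\ forall y, y < L -> lmem y L -> ~ derives M u y.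

Definition consistent (L : nat) : Prop := exists M, forall u, avoids L u M.

Lemma avoids_local L u (M M' : set nat) : (forall n, n <= u -> M n <-> M' n) ->
  avoids L u M -> avoids L u M'.
Proof.
move=> MM' [sM h]; split; first exact: scott_local sM.
move=> y yL my [vu [yu cu]]; apply: (h y yL my); split=> //; split=> //.
by apply: consist_local cu => n nu; apply: iff_sym; exact: MM'.
Qed.

Lemma avoidsP L M : (forall u, avoids L u M) <->
  (forall u, scott u M) /\ forall y, lmem y L -> ~ facts M y.
Proof.
split=> [h|[h h'] u].
  split=> [u|y yL /factsE[u du]]; first by have [] := h u.
  by have [_ /(_ y (lmem_lt yL) yL)] := h u.
by split=> // y _ yL du; apply: (h' y yL); apply/factsE; exists u.
Qed.

Lemma avoids_cons y L u M : avoids (lcons y L) u M <->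
  avoids L u M /\ ~ derives M u y.
Proof.
split=> [[sM h]|[[sM h] hy]].
  have h' z : lmem z (lcons y L) -> ~ derives M u z.
    by move=> zL; apply: h => //; exact: lmem_lt.
  split; last by apply: h'; apply/lmem_cons; left.
  by split=> // z _ zL; apply: h'; apply/lmem_cons; right.
by split=> // z _ /lmem_cons[-> //|zL]; apply: h => //; exact: lmem_lt.
Qed.

Lemma recp_avoids X fL fu fz : recf X fL -> recf X fu -> recf X fz ->
  recp X (fun n => avoids (fL n) (fu n) (lset (fz n))).
Proof.
move=> rL ru rz; rewrite /avoids /derives.
have rZ : recp X (fun p => (fun n m => lmem m (fz n)) (nfst p) (nsnd p)) by rec.
apply: recp_and; first exact: (recp_scott rZ).
apply: recp_ball => //; apply: recp_imp; first by rec.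
apply: recp_not; apply: recp_and; first by rec.
apply: recp_and; first by rec.
by apply: (@recp_consist X (fun n m => lmem m (fz (nfst n)))); rec.
Qed.

Lemma recf_full_lst X f : recf X f -> recf X (fun n => full_lst (f n)).
Proof. by move=> rf; rewrite /full_lst; rec. Qed.

Lemma recp_derives X f g h : recf X f -> recf X g -> recf X h ->
  recp X (fun n => derives (lset (f n)) (g n) (h n)).
Proof.
move=> rf rg rh; rewrite /derives.
apply: recp_and; first by rec.
apply: recp_and; first by rec.
by apply: (@recp_consist X (fun n m => lmem m (f n))); rec.
Qed.

Lemma consistentP L : consistent L <->
  forall m, exists z, z < (full_lst m).+1 /\
    forall w, w < m -> avoids L w (lset z).
Proof. by apply: compactness_lst; exact: avoids_local. Qed.

Lemma recp_consistent : recp (jump set0) consistent.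
Proof.
apply: (@recp_iff _ (fun L => forall m, exists z, z < (full_lst m).+1 /\
    forall w, w < m -> avoids L w (lset z))).
  by move=> L; apply: iff_sym; exact: consistentP.
apply: (@pi1_jump (fun L m => exists z, z < (full_lst m).+1 /\
    forall w, w < m -> avoids L w (lset z))).
apply: recp_bex; first by apply: recf_succ; apply: recf_full_lst; rec.
apply: recp_ball; first by rec.
by apply: recp_avoids; rec.
Qed.

Section ConeAvoidance.
Variable C : set nat.
Hypothesis C_jump : recp (jump set0) C.
Hypothesis C_noncomp : ~ turing_le C set0.

(* If every member of the class satisfied [facts M (ent e x (C x))] for all
   [x], compactness would make [C] computable. *)
Lemma diagonalize L e : consistent L ->
  exists x, consistent (lcons (ent e x `[< C x >]) L).
Proof.
move=> [M hM]; apply: contrapT => /forallNP hL; apply: C_noncomp.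
pose forces x k := forall z, z < (full_lst (nfst k)).+1 ->
  (forall w, w < nfst k -> avoids L w (lset z)) ->
  exists u, u < nfst k /\ derives (lset z) u (ent e x (nsnd k)).
have factsC x : facts M (ent e x `[< C x >]).
  apply: contrapT => nf; apply: (hL x); exists M => u.
  apply/avoids_cons; split=> // d; apply: nf; apply/factsE; by exists u.
have forcesC x k : forces x k -> nsnd k = `[< C x >].
  move=> hk; have [z [zm hz]] := initial_lst M (nfst k).
  have agree n : n < nfst k -> M n <-> lset z n.
    by move=> nk; rewrite hz; split=> [|[]//].
  have [||u [uk [vu [yu cu]]]] := hk z; first by rewrite ltnS.
    move=> w wk; apply: avoids_local (hM w) => n nw.
    by apply: agree; exact: leq_ltn_trans wk.
  apply: facts_det (factsC x); exists u; split=> //.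
  apply: consist_local cu => n nu; apply: iff_sym; apply: agree.
  exact: leq_ltn_trans uk.
have [||f [rf hf]] := @recf_choose set0 forces.
- rewrite /forces; apply: recp_ball.
    by apply: recf_succ; apply: recf_full_lst; rec.
  apply: recp_imp.
    by apply: recp_ball; [rec | apply: recp_avoids; rec].
  by apply: recp_bex; [rec | apply: recp_derives; rec].
- move=> x; have /consistentP/existsNP[m hm] := hL x.
  exists (npair m `[< C x >]) => z zm hz; rewrite nfstK nsndK in zm hz *.
  apply: contrapT => nu; apply: hm; exists z; split=> // w wm.
  by apply/avoids_cons; split; [exact: hz | move=> d; apply: nu; exists w].
have : recf set0 (fun x => nsnd (f x)) by rec.
by apply: recf_ext => x; exact: forcesC.
Qed.

(* Forcing with the classes [avoids L], computably in the jump: stage [n]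
   decides the fact [n], which makes [M] low, and then diagonalizes against the
   program [n]. *)
Lemma low_cone_avoiding_scott : exists M, [/\ forall u, scott u M,
  recp (jump set0) (facts M) & ~ turing_le C M].
Proof.
have [||g [rg hg]] := @recf_choose (jump set0) (fun p x =>
  consistent (lcons (ent (nsnd p) x `[< C x >]) (nfst p)) \/
  ~ consistent (nfst p)).
- have := recp_consistent => rc; rec.
- move=> p; have [/(@diagonalize _ (nsnd p))[x hx]|] := EM (consistent (nfst p)).
    by exists x; left.
  by exists 0; right.
pose decide n L := if `[< consistent (lcons n L) >] then lcons n L else L.
pose next n L := lcons (ent n (g (npair (decide n L) n))
  `[< C (g (npair (decide n L) n)) >]) (decide n L).
pose seqL n := prim next 0 n.
have rL : recf (jump set0) seqL.
  rewrite /seqL /next /decide; have := recp_consistent => rc; rec.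
have cL n : consistent (seqL n).
  elim: n => [|n IH].
    have [M hM] := scott_inhabited; exists M; apply/avoidsP; split=> //.
    by move=> y /lmem0.
  rewrite /= -/(seqL n) /next.
  have : consistent (decide n (seqL n)) by rewrite /decide; case: asboolP.
  by have := hg (npair (decide n (seqL n)) n); rewrite nfstK nsndK => -[].
have stepL n y : lmem y (decide n (seqL n)) -> lmem y (seqL n.+1).
  by move=> h; rewrite /= /next; apply/lmem_cons; right.
have monoL n n' y : n <= n' -> lmem y (seqL n) -> lmem y (seqL n').
  elim: n' => [|n' IH]; first by rewrite leqn0 => /eqP ->.
  rewrite leq_eqVlt => /orP[/eqP <- //|]; rewrite ltnS => nn' /(IH nn') h.
  apply: stepL; rewrite /decide; case: ifP => // _.
  by apply/lmem_cons; right.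
have [||M hM] := @compactness (fun u => avoids (seqL (nfst u)) (nsnd u)).
- move=> u M M' MM'; apply: avoids_local => n nu; apply: MM'.
  exact: leq_trans nu (nsnd_le _).
- move=> m; have [M /avoidsP[sM hM]] := cL m; exists M => u um.
  move: (nsnd u); apply/avoidsP; split=> // y hy; apply: hM; apply: monoL hy.
  exact: leq_trans (nfst_le _) (ltnW um).
have {}hM n : forall u, avoids (seqL n) u M.
  by move=> u; have := hM (npair n u); rewrite nfstK nsndK.
have sM u : scott u M by have [] := hM 0 u.
have nfM n y : lmem y (seqL n) -> ~ facts M y.
  by have /avoidsP[_] := hM n; apply.
exists M; split=> //.
  apply: (@recp_iff _ (fun n => ~ lmem n (seqL n.+1))); last by rec.
  move=> n; split=> [nL|fn /nfM]; last exact.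
  apply: contrapT => nf; apply: nL; apply: stepL; rewrite /decide.
  case: asboolP => [_|]; first by apply/lmem_cons; left.
  case; exists M; apply/avoidsP; split=> // y /lmem_cons[-> //|]; exact: nfM.
move=> [c hc]; pose x := g (npair (decide (godel c) (seqL (godel c))) (godel c)).
apply: (@nfM (godel c).+1 (ent (godel c) x `[< C x >])).
  by rewrite /= /next; apply/lmem_cons; left.
by apply/factsP; exact: hc.
Qed.

End ConeAvoidance.

Lemma low_sigma1 M (P : nat -> nat -> Prop) : recp (jump set0) (facts M) ->
  recp M (fun p => P (nfst p) (nsnd p)) ->
  recp (jump set0) (fun n => exists k, P n k).
Proof.
move=> low rP; have [c hc] := recp_not rP.
have hc' n k : eval M c (npair n k) `[< ~ P n k >].
  by have := hc (npair n k); rewrite nfstK nsndK.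
apply: (@recp_iff _ (fun n => facts M (ent (godel (Comp Zero (Mu c))) n 0))).
  move=> n; rewrite factsP; split.
    move=> [v [hv _] _]; exists v; have := eval_det hv (hc' n v).
    by case: asboolP => // /contrapT.
  move=> [k Pk]; have ex : exists k, `[< P n k >] by exists k; apply/asboolP.
  exists (ex_minn ex) => //; case: ex_minnP => m /asboolP Pm min; split.
    by have := hc' n m; case: asboolP.
  move=> j jm; exists 0; have := hc' n j; case: asboolP => // /contrapT /asboolP /min.
  by rewrite leqNgt jm.
apply: (recp_comp low (f := fun n => ent (godel (Comp Zero (Mu c))) n 0)).
by rec.
Qed.

Lemma low_pi1 M (P : nat -> nat -> Prop) : recp (jump set0) (facts M) ->
  recp M (fun p => P (nfst p) (nsnd p)) ->
  recp (jump set0) (fun n => forall k, P n k).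
Proof.
move=> low rP; apply: (@recp_iff _ (fun n => ~ exists k, ~ P n k)).
  move=> n; split=> [h k|h [k]]; last exact.
  by apply: contrapT => nk; apply: h; exists k.
by apply/recp_not/(@low_sigma1 M (fun n k => ~ P n k)) => //; rec.
Qed.

Lemma low_jump M P : recp (jump set0) (facts M) -> recp M P ->
  recp (jump set0) P.
Proof.
move=> low rP; apply: (@recp_iff _ (fun n => exists k : nat, P n)).
  by move=> n; split=> [[]|Pn] //; exists 0.
by apply: (@low_sigma1 M (fun n _ => P n)) => //; rec.
Qed.

(** * The forcing *)

Definition part (i : bool) (st : nat) : nat := if i then part1 st else part0 st.
Definition functional (i : bool) (j : nat) : nat := if i then nsnd j else nfst j.
Definition color (i : bool) (A : set nat) : set nat := if i then ~` A else A.
Definition unbounded (Z : set nat) : Prop := forall n, exists x, n <= x /\ Z x.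

Definition constant_on (e D b : nat) (Z : set nat) : Prop :=
  forall w, ~ splits e D b Z w.

Definition solves (X : set nat) (st : nat) (Z : set nat) : Prop :=
  forall w, ~ refutes X st Z w.

Lemma part_state i l D0 D1 b :
  part i (state l D0 D1 b) = if i then D1 else D0.
Proof. by case: i; have [] := stateK l D0 D1 b. Qed.

Lemma stack_state l D0 D1 b : stack (state l D0 D1 b) = l.
Proof. by have [] := stateK l D0 D1 b. Qed.

Lemma bound_state l D0 D1 b : bound (state l D0 D1 b) = b.
Proof. by have [] := stateK l D0 D1 b. Qed.

Lemma recf_part i X f : recf X f -> recf X (fun n => part i (f n)).
Proof. by rewrite /part; case: i => rf; rec. Qed.

Lemma recf_functional i X f : recf X f -> recf X (fun n => functional i (f n)).
Proof. by rewrite /functional; case: i => rf; rec. Qed.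

Definition ancestor (l' l : nat) : Prop := exists t, iter t below l = l'.

Lemma ancestor_refl l : ancestor l l.
Proof. by exists 0. Qed.

Lemma ancestor_trans l1 l2 l3 : ancestor l1 l2 -> ancestor l2 l3 -> ancestor l1 l3.
Proof. by move=> [s <-] [t <-]; exists (s + t); rewrite iterD. Qed.

Lemma ancestor_below l : ancestor (below l) l.
Proof. by exists 1. Qed.

Lemma ancestor_le l' l : ancestor l' l -> l' <= l.
Proof. by move=> [t <-]; exact: iter_below_le. Qed.

Lemma ancestorE l' l : ancestor l' l -> l' = l \/ ancestor l' (below l).
Proof. by move=> [[|t]] <-; [left | right; exists t; rewrite iterSr]. Qed.

Lemma ancestor0 l : ancestor 0 l.
Proof. by exists l; exact: iter_below_ge. Qed.

Lemma ancestor_child l' l : ancestor l' l -> l' <> l ->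
  exists s, [/\ ancestor s l, s <> 0 & below s = l'].
Proof.
move=> [t]; elim: t l' => [|t IH] l' /= h ne; first by case: ne.
have [t0|t0] := EM (iter t below l = 0).
  apply: IH => //; by rewrite t0 below0 in h; rewrite t0 h.
by exists (iter t below l); split=> //; exists t.
Qed.

Lemma ancestor_reservoir M l' l : ancestor l' l ->
  reservoir M l `<=` reservoir M l'.
Proof.
move=> [t]; elim: t l => [|t IH] l /=; first by move=> ->.
rewrite -iterS iterSr => /IH h x Rx; apply: h.
by have [->|l0] := EM (l = 0); [rewrite below0 | have [] := (reservoirS M x l0).1 Rx].
Qed.

(* The chain under [l] reaches [0] within [l] steps, so [t] can be bounded. *)
Lemma recp_ancestor X (P : nat -> Prop) : recp X P ->
  recp X (fun st => exists s, [/\ ancestor s (stack st), s <> 0 & P s]).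
Proof.
move=> rP; apply: (@recp_iff _ (fun st => exists t, t < stack st /\
  (iter t below (stack st) <> 0 /\ P (iter t below (stack st))))); last by rec.
move=> st; split=> [[t [_ [t0 Pt]]]|[s [[t ts] s0 Ps]]].
  by exists (iter t below (stack st)); split=> //; exists t.
exists t; rewrite ts; split=> //; rewrite ltnNge; apply/negP => /iter_below_ge.
by rewrite ts.
Qed.

Lemma refutesP X a Z w : refutes X a Z w <->
  exists i, splits (functional i (depth (stack a))) (part i a) (bound a)
    (X `&` color i Z) w.
Proof.
split=> [[h|h]|[[] h]]; [by exists false|by exists true|by right|by left].
Qed.

Lemma converges_weaken e D D' b b' (Z Z' : set nat) L x v :
  (forall n, lmem n D' <-> lmem n D) -> (forall n, lmem n D -> n < b) ->
  b <= b' -> (forall n, b' <= n -> Z' n -> Z n) ->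
  converges e D' b' Z' L x v -> exists L', converges e D b Z L' x v.
Proof.
move=> DD' Db bb' ZZ' h; have [_ [_ [_ hZ]]] := h.
apply: (facts_converges _ _ _ (converges_facts h)) => n.
- by left; apply/DD'.
- by case=> [/DD' //|[bn _] nb]; lia.
- case=> [/DD'/Db|[bn nL]] bn'; first by lia.
  apply: ZZ' => //; apply: hZ => //.
  by have [_ ? _] := ent_ge 4 n 1; have := lmem_lt nL; lia.
Qed.

Lemma constant_weaken e D D' b b' (Z Z' : set nat) :
  (forall n, lmem n D' <-> lmem n D) -> (forall n, lmem n D -> n < b) ->
  b <= b' -> (forall n, b' <= n -> Z' n -> Z n) ->
  constant_on e D b Z -> constant_on e D' b' Z'.
Proof.
move=> DD' Db bb' ZZ' cst w [L [_ [L' [_ [x [_ [v [_ [v' [_ [vv' [h h']]]]]]]]]]]].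
have [L1 h1] := converges_weaken DD' Db bb' ZZ' h.
have [L2 h2] := converges_weaken DD' Db bb' ZZ' h'.
by have [w' /cst] := converges_splits h1 h2 vv'.
Qed.

Lemma constant_computes (C M Y Z : set nat) e D b : recp M Z ->
  (forall n, lmem n D -> Y n) -> (forall n, Y n -> n < b -> lmem n D) ->
  (forall n, Y n -> b <= n -> Z n) -> constant_on e D b Z ->
  (forall x, facts Y (ent e x `[< C x >])) -> turing_le C M.
Proof.
move=> rZ DY YD YZ cst hC.
have conv x : exists L, converges e D b Z L x `[< C x >].
  exact: facts_converges DY YD YZ (hC x).
have [||f [rf hf]] := @recf_choose M
    (fun x k => converges e D b Z (nfst k) x (nsnd k)).
- by apply: (@recp_converges M (fun _ n => Z n)); rec.
- by move=> x; have [L hL] := conv x; exists (npair L `[< C x >]); rewrite nfstK nsndK.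
suff : recf M (fun x => nat_of_bool `[< C x >]) by [].
apply: (@recf_ext _ (fun x => nsnd (f x))); last by rec.
move=> x; apply: contrapT => ne; have [L hL] := conv x.
by have [w /cst] := converges_splits (hf x) hL ne.
Qed.

Section Moves.
Variables A C M : set nat.
Local Notation R := (reservoir M).

(* The computation must not depend on numbers [>= b], hence the bound on [L]. *)
Definition mistaken (e D b : nat) : Prop :=
  exists L, L < b /\ exists x, x < L /\ exists v, v < L /\
    (valid L /\ lmem (ent e x v) L /\ consist (lset D) L /\ v <> `[< C x >]).

Definition settled_at (i : bool) (st l : nat) : Prop :=
  constant_on (functional i (depth (stack st))) (part i st) (bound st) (R l) \/
  mistaken (functional i (depth (stack st))) (part i st) (bound st).

Definition pair_settled (st l : nat) : Prop :=
  settled_at false st l \/ settled_at true st l.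

Lemma settledW i st l : settled_at i st l -> pair_settled st l.
Proof. by case: i => h; [right|left]. Qed.

Definition add_bound (st : nat) : nat :=
  if `[< R (stack st) (bound st) >] then
    if `[< A (bound st) >] then
      state (stack st) (lcons (bound st) (part0 st)) (part1 st) (bound st).+1
    else state (stack st) (part0 st) (lcons (bound st) (part1 st)) (bound st).+1
  else state (stack st) (part0 st) (part1 st) (bound st).+1.

Definition exhausted (st : nat) : Prop :=
  forall x, ~ (bound st <= x /\ R (stack st) x).

Definition restack (st l : nat) : nat := state l (part0 st) (part1 st) (bound st).

Definition branch (st fl : nat) : nat := push st fl (depth (stack st)).

(* Moves: 0 skips the bound, 1 adds it to the part it belongs to, 2 pops an
   exhausted reservoir, 3 declares the current pair of functionals settled by the
   reservoir as it is, 4 and 5 restrict the reservoir to either side of a solution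
   of the splitting problem. *)
Definition play (st m : nat) : nat :=
  if `[< m = 0 >] then state (stack st) (part0 st) (part1 st) (bound st).+1
  else if `[< m = 1 >] then add_bound st
  else if `[< m = 2 /\ exhausted st >] then restack st (below (stack st))
  else if `[< m = 3 /\ pair_settled st (stack st) >] then restack st (branch st 2)
  else if `[< (m = 4 \/ m = 5) /\ solves (R (stack st)) st (column M st) >]
    then restack st (branch st (m - 4))
  else st.

Lemma recp_settled_at i : recp (jump set0) C -> recp (jump set0) (facts M) ->
  recp (jump set0) (fun st => settled_at i st (stack st)).
Proof.
move=> rC low; rewrite /settled_at; apply: recp_or.
  apply: (low_pi1 low (P := fun st w => ~ splits
    (functional i (depth (stack st))) (part i st) (bound st) (R (stack st)) w)).
  apply: recp_not; apply: (@recp_splits M (fun p => R (stack (nfst p))));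
    try (by apply: recf_functional; rec); try (by apply: recf_part; rec);
    try by rec.
  apply: (@recp_reservoir M (fun _ n => M n)); try by rec.
  by have := recp_oracle M => ?; rec.
rewrite /mistaken.
have rf : recf (jump set0) (fun n => functional i (depth (stack n))).
  by apply: recf_functional; rec.
have rp : recf (jump set0) (fun n => part i n) by apply: recf_part; rec.
apply: recp_bex; first by rec.
apply: recp_bex; first by rec.
apply: recp_bex; first by rec.
apply: recp_and; first by rec.
apply: recp_and.
  apply: recp_lmem; last by rec.
  by apply: recf_ent; [apply: recf_functional|..]; rec.
apply: recp_and; last by rec.
apply: (@recp_consist _ (fun n m => lmem m (part i (nfst (nfst (nfst n)))))).
  by apply: recp_lmem; [|apply: recf_part]; rec.
by rec.
Qed.

Lemma recf_step : recp (jump set0) A -> recp (jump set0) C ->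
  recp (jump set0) (facts M) ->
  recf (jump set0) (fun p => play (nfst p) (nsnd p)).
Proof.
move=> rA rC low.
have rM := recp_oracle M.
have rR : recp M (fun p => R (nfst p) (nsnd p)).
  by apply: (@recp_reservoir M (fun _ n => M n)); rec.
have rR' := low_jump low rR.
have rE : recp (jump set0) exhausted.
  by apply: (low_pi1 low (P := fun st x => ~ (bound st <= x /\ R (stack st) x)));
    apply: recp_not; apply: recp_and; [rec | apply: (recp_comp2 rR); rec].
have rS : recp (jump set0) (fun st => pair_settled st (stack st)).
  by apply: recp_or; exact: recp_settled_at.
have rV : recp (jump set0) (fun st => solves (R (stack st)) st (column M st)).
  apply: (low_pi1 low (P := fun st w =>
    ~ refutes (R (stack st)) st (column M st) w)); apply: recp_not.
  apply: (@recp_refutes M (fun n => R (stack (nfst n)))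
    (fun n => column M (nfst n))); try by rec.
  by apply: (recp_comp2 rR); rec.
have rB : recf (jump set0) add_bound.
  rewrite /add_bound; apply: recf_if; last by rec.
    by apply: (recp_comp2 rR'); rec.
  by rec.
rewrite /play /restack /branch.
apply: recf_if; [by rec|by rec|].
apply: recf_if; [by rec|by rec|].
apply: recf_if; [by rec|by rec|].
apply: recf_if; [|by rec|].
  by apply: recp_and; [rec | apply: (recp_comp rS); rec].
apply: recf_if; [|by rec|by rec].
by apply: recp_and; [rec | apply: (recp_comp rV); rec].
Qed.

End Moves.

Section Dynamics.
Variables A C M : set nat.
Local Notation R := (reservoir M).
Local Notation step := (play A C M).
Local Notation settled := (pair_settled C M).

Lemma stack_restack st l : stack (restack st l) = l.
Proof. exact: stack_state. Qed.

Lemma bound_restack st l : bound (restack st l) = bound st.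
Proof. exact: bound_state. Qed.

Lemma part_restack i st l : part i (restack st l) = part i st.
Proof. by rewrite /restack part_state; case: i. Qed.

Lemma stack_stepP st m : [\/ stack (step st m) = stack st,
  exhausted M st /\ stack (step st m) = below (stack st) |
  exists fl, [/\ stack (step st m) = branch st fl, bound (step st m) = bound st &
    ((fl = 2 /\ settled st (stack st)) \/
     (fl < 2 /\ solves (R (stack st)) st (column M st)))]].
Proof.
rewrite /play; case: asboolP => _; first by rewrite stack_state; constructor 1.
case: asboolP => _.
  by rewrite /add_bound; do ?case: ifP; rewrite stack_state; constructor 1.
case: asboolP => [[_ ?]|_]; first by constructor 2; rewrite stack_restack.
case: asboolP => [[_ ?]|_].
  by constructor 3; exists 2; rewrite stack_restack bound_restack; split=> //; left.
case: asboolP => [[m45 ?]|_]; last by constructor 1.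
constructor 3; exists (m - 4); rewrite stack_restack bound_restack; split=> //; right.
by split=> //; lia.
Qed.

Lemma bound_step st m : bound st <= bound (step st m).
Proof.
rewrite /play; case: asboolP => _; first by rewrite bound_state.
case: asboolP => _; first by rewrite /add_bound; do ?case: ifP; rewrite bound_state.
by do 3 (case: asboolP => _; first by rewrite bound_restack).
Qed.

Lemma part_stepW i st m n : lmem n (part i st) -> lmem n (part i (step st m)).
Proof.
move=> h; rewrite /play; case: asboolP => _.
  by rewrite part_state; case: i h.
case: asboolP => _.
  rewrite /add_bound; case: ifP => _; last by rewrite part_state; case: i h.
  by case: ifP => _; rewrite part_state; case: i h => h //; apply/lmem_cons; right.
by do 3 (case: asboolP => _; first by rewrite part_restack).
Qed.

Lemma part_step i st m n : lmem n (part i (step st m)) -> lmem n (part i st) \/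
  [/\ n = bound st, bound (step st m) = n.+1, R (stack st) n & color i A n].
Proof.
rewrite /play; case: asboolP => _.
  by rewrite part_state; case: i; left.
case: asboolP => _; last first.
  by do 3 (case: asboolP => _; first by rewrite part_restack; left); left.
rewrite /add_bound; case: asboolP => [Rb|_]; last first.
  by rewrite part_state; case: i; left.
case: asboolP => Ab; rewrite part_state bound_state; case: i => h; try (by left).
  by have [->|?] := (lmem_cons _ _ _).1 h; [right|left].
by have [->|?] := (lmem_cons _ _ _).1 h; [right|left].
Qed.

Definition recorded (l' st : nat) : Prop :=
  [/\ bound (origin l') <= bound st, settled (origin l') l',
      depth l' = (depth (below l')).+1 &
      forall i n, (n < bound (origin l') ->
          lmem n (part i st) <-> lmem n (part i (origin l'))) /\
        (lmem n (part i (origin l')) -> n < bound (origin l')) /\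
        (bound (origin l') <= n -> lmem n (part i st) -> R l' n)].

Definition coherent (st : nat) : Prop :=
  (forall i n, lmem n (part i st) -> n < bound st /\ color i A n) /\
  forall l', ancestor l' (stack st) -> l' <> 0 -> recorded l' st.

Lemma branch_neq0 st fl : branch st fl <> 0.
Proof. by []. Qed.

Lemma branchK st fl : [/\ origin (branch st fl) = st, flag (branch st fl) = fl,
  depth (branch st fl) = (depth (stack st)).+1
  & below (branch st fl) = stack st].
Proof. exact: pushK. Qed.

Lemma reservoir_branch st fl x : R (branch st fl) x <-> R (stack st) x /\
  (fl = 0 -> column M st x) /\ (fl = 1 -> ~ column M st x).
Proof.
rewrite (reservoirS M x (@branch_neq0 st fl)) /side.
by have [-> -> _ ->] := branchK st fl; split=> -[].
Qed.

Lemma solves_settled st fl : fl < 2 ->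
  solves (R (stack st)) st (column M st) -> settled st (branch st fl).
Proof.
move=> fl2 h; case: fl fl2 => [|[|//]] _; [left|right]; left=> w;
  move=> hw; apply: (h w); [left|right]; move: hw; apply: splits_sub => x;
  by move=> /reservoir_branch[Rx [h0 h1]]; split=> //; auto.
Qed.

Lemma settled_sub st (l l' : nat) : R l' `<=` R l -> settled st l -> settled st l'.
Proof.
move=> ll' [[h|h]|[h|h]]; [left; left|left; right|right; left|right; right] => //.
- by move=> w /(splits_sub ll'); exact: h.
- by move=> w /(splits_sub ll'); exact: h.
Qed.

Lemma recorded_step l' st m : ancestor l' (stack st) ->
  recorded l' st -> recorded l' (step st m).
Proof.
move=> anc [b s d h]; split=> //; first exact: leq_trans (bound_step st m).
move=> i n; have [h1 [h2 h3]] := h i n; split=> [nb|]; last first.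
  split=> // bn /part_step[|[_ _ Rn _]]; first exact: h3.
  exact: ancestor_reservoir anc _ Rn.
rewrite -h1 //; split=> [/part_step[//|[nE _ _ _]]|]; last exact: part_stepW.
by lia.
Qed.

Lemma coherent_step st m : coherent st -> coherent (step st m).
Proof.
move=> [h1 h2]; split.
  move=> i n /part_step[/h1[nb cn]|[_ -> _ cn]]; last by [].
  by split=> //; exact: leq_trans (bound_step st m).
have old l' : ancestor l' (stack st) -> l' <> 0 -> recorded l' (step st m).
  by move=> anc l0; apply: recorded_step => //; exact: h2.
move=> l'; case: (stack_stepP st m) => [->|[_ ->]|[fl [-> bfl hfl]]]; first exact: old.
  by move=> anc; apply: old; exact: ancestor_trans (ancestor_below _).
move=> /ancestorE[->|anc] l0; last first.
  by apply: old => //; move: anc; have [_ _ _ ->] := branchK st fl.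
have [oE _ dE bE] := branchK st fl; split; rewrite ?oE ?bE //.
- exact: bound_step.
- case: hfl => [[_ h]|[fl2 h]]; last exact: solves_settled.
  by apply: settled_sub h => x /reservoir_branch[].
move=> i n; split.
  move=> nb; split=> [/part_step[//|[nE _ _ _]]|]; last exact: part_stepW.
  by rewrite nE ltnn in nb.
by split=> [/h1[]|bn /part_step[/h1[]|[nE bn1 Rn _]]] //; lia.
Qed.

Definition reach (st st' : nat) : Prop := exists ms, foldl step st ms = st'.

Lemma reach_refl st : reach st st.
Proof. by exists [::]. Qed.

Lemma reach_trans st1 st2 st3 : reach st1 st2 -> reach st2 st3 -> reach st1 st3.
Proof. by move=> [s <-] [t <-]; exists (s ++ t); rewrite foldl_cat. Qed.

Lemma reach_step st m : reach st (step st m).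
Proof. by exists [:: m]. Qed.

Lemma reach_ind (P : nat -> Prop) st : P st ->
  (forall st', reach st st' -> P st' -> forall m, P (step st' m)) ->
  forall st', reach st st' -> P st'.
Proof.
move=> P0 PS _ [ms <-]; elim/last_ind: ms => // ms m IH.
by rewrite -cats1 foldl_cat; apply: PS => //; exists ms.
Qed.

Lemma reach_coherent st st' : coherent st -> reach st st' -> coherent st'.
Proof. by move=> i0; apply: reach_ind => // s _ + m; exact: coherent_step. Qed.

Lemma ancestor_step l' st m : unbounded (R l') ->
  ancestor l' (stack st) -> ancestor l' (stack (step st m)).
Proof.
move=> u anc; case: (stack_stepP st m) => [-> //|[ex ->]|[fl [-> _ _]]].
  have [E|//] := ancestorE anc; have [x [bx Rx]] := u (bound st).
  by case: (ex x); rewrite -E.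
by apply: ancestor_trans anc _; exists 1 => /=; have [_ _ _ ->] := branchK st fl.
Qed.

Lemma ancestor_reach l' st st' : unbounded (R l') -> reach st st' ->
  ancestor l' (stack st) -> ancestor l' (stack st').
Proof.
move=> u r anc; move: st' r; apply: reach_ind => // s _ + m.
exact: ancestor_step.
Qed.

Lemma part_reach i st st' n : reach st st' -> n < bound st ->
  lmem n (part i st') <-> lmem n (part i st).
Proof.
move=> r nb; suff [] : bound st <= bound st' /\
    (lmem n (part i st') <-> lmem n (part i st)) by [].
move: st' r; apply: reach_ind => // s _ [bs e] m.
split; first exact: leq_trans (bound_step s m).
rewrite -e; split=> [/part_step[//|[nE _ _ _]]|]; last exact: part_stepW.
by lia.
Qed.

Lemma step0 st : [/\ stack (step st 0) = stack st,
  bound (step st 0) = (bound st).+1 &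
  forall i n, lmem n (part i (step st 0)) <-> lmem n (part i st)].
Proof.
rewrite /play asboolT // stack_state bound_state; split=> // i n.
by rewrite part_state; case: i.
Qed.

Lemma step1 st : R (stack st) (bound st) -> [/\ stack (step st 1) = stack st,
  bound (step st 1) = (bound st).+1 &
  forall i n, lmem n (part i (step st 1)) <->
    lmem n (part i st) \/ (n = bound st /\ color i A n)].
Proof.
move=> Rb; rewrite /play asboolF // asboolT // /add_bound asboolT //.
have other D n (Q : Prop) : (n = bound st -> ~ Q) ->
    lmem n D <-> lmem n D \/ (n = bound st /\ Q).
  by move=> nQ; split=> [|[//|[/nQ]]]; [left|].
have new D n (Q : Prop) : (n = bound st -> Q) ->
    lmem n (lcons (bound st) D) <-> lmem n D \/ (n = bound st /\ Q).
  move=> hQ; rewrite lmem_cons.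
  by split=> [[/[dup] /hQ|]|[|[]]]; [right|left|right|left].
case: asboolP => Ab; rewrite stack_state bound_state; split=> // -[] n;
  rewrite part_state; [apply: other|apply: new|apply: new|apply: other];
  by move=> ->.
Qed.

Lemma fill st (E : set nat) B : E `<=` R (stack st) -> bound st <= B ->
  exists st', [/\ reach st st', stack st' = stack st, bound st' = B &
    forall i n, lmem n (part i st') <-> lmem n (part i st) \/
      [/\ bound st <= n, n < B, E n & color i A n]].
Proof.
move=> ER; elim: B => [|B IH].
  rewrite leqn0 => /eqP b0; exists st; split=> //; first exact: reach_refl.
  by move=> i n; split=> [|[//|[]]]; [left|].
rewrite leq_eqVlt => /orP[/eqP bB|].
  exists st; split=> //; first exact: reach_refl.
  by move=> i n; split=> [|[//|[]]]; [left|lia].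
rewrite ltnS => /[dup] bB /IH[st1 [r s1 b1 p1]].
have [EB|nEB] := EM (E B).
  have [|s2 b2 p2] := @step1 st1; first by rewrite s1 b1; exact: ER.
  exists (step st1 1); rewrite s2 b2 b1 s1; split=> //.
    exact: reach_trans (reach_step _ _).
  move=> i n; rewrite p2 p1 b1.
  split=> [[[h|[? ? ? ?]]|[-> cB]]|[h|[? nB ? ?]]].
  - by left.
  - by right; split=> //; lia.
  - by right; split=> //; lia.
  - by left; left.
  - have [nB'|nB'] := EM (n = B); first by right.
    by left; right; split=> //; lia.
have [s2 b2 p2] := step0 st1.
exists (step st1 0); rewrite s2 b2 b1 s1; split=> //.
  exact: reach_trans (reach_step _ _).
move=> i n; rewrite p2 p1; split=> [[h|[? ? ? ?]]|[h|[? nB En ?]]].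
- by left.
- by right; split=> //; lia.
- by left.
- right; split=> //; have [nB'|] := EM (n = B); last by lia.
  by case: nEB; rewrite -nB'.
Qed.

Lemma pad st B : bound st <= B ->
  exists st', [/\ reach st st', stack st' = stack st, bound st' = B &
    forall i n, lmem n (part i st') <-> lmem n (part i st)].
Proof.
move=> bB; have [//|st' [r s b p]] := @fill st set0 B _ bB.
by exists st'; split=> // i n; rewrite p; split=> [[|[]]|]; [| |left].
Qed.

Lemma pop_to_unbounded st : exists st',
  [/\ reach st st', ancestor (stack st') (stack st) & unbounded (R (stack st'))].
Proof.
move: {-1}(stack st) (erefl (stack st)) => l; elim/ltn_ind: l st => l IH st sl.
have [u|] := EM (unbounded (R l)).
  by exists st; rewrite sl; split=> //; [exact: reach_refl|exact: ancestor_refl].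
move=> /existsNP[n /forallNP hn].
have l0 : l <> 0 by move=> l0; apply: (hn n); rewrite l0.
have [|st1 [r1 s1 b1 _]] := @pad st (maxn n (bound st)); first exact: leq_maxr.
have s2 : stack (step st1 2) = below l.
  rewrite /play asboolF // asboolF // asboolT ?stack_restack ?s1 ?sl //.
  by split=> // x [bx]; rewrite s1 sl => Rx; apply: (hn x); split=> //; lia.
have [st' [r' a' u']] := IH _ (below_lt l0) _ s2.
exists st'; split=> //.
  exact: reach_trans r1 (reach_trans (reach_step _ _) r').
exact: ancestor_trans a' (ancestor_below _).
Qed.

End Dynamics.

(** * Genericity *)

Lemma recf_half X f : recf X f -> recf X (fun n => (f n)./2).
Proof.
apply: (@recf_comp X half).
have [||h [rh hh]] := @recf_choose X (fun n k => k + k <= n /\ n <= (k + k).+1).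
- by rec.
- by move=> n; exists n./2; have := odd_double_half n; case: odd; lia.
apply: recf_ext rh => n; have := hh n; have := odd_double_half n.
by case: odd; lia.
Qed.

Lemma recf_odd X f : recf X f -> recf X (fun n => odd (f n) : nat).
Proof.
move=> rf; apply: (@recf_ext _ (fun n => f n - ((f n)./2 + (f n)./2))).
  by move=> n; have := odd_double_half (f n); case: odd; lia.
by apply: recf_sub => //; apply: recf_add; exact: recf_half.
Qed.

Lemma recp_join_left A B : recp (join A B) A.
Proof.
have r : recf (join A B) (fun n => n + n) by rec.
apply: recp_iff (recp_comp (@recp_oracle (join A B)) r) => n.
by rewrite /join /= addnn odd_double doubleK.
Qed.

Lemma recp_join_right A B : recp (join A B) B.
Proof.
have r : recf (join A B) (fun n => (n + n).+1) by rec.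
apply: recp_iff (recp_comp (@recp_oracle (join A B)) r) => n.
by rewrite /join /= addnn odd_double /= uphalf_double.
Qed.

(* A binary string is read as a sequence of moves, the block [0^m 1] standing
   for the move [m]; the run also records the length of the string. *)
Section Run.
Variables A C M : set nat.
Local Notation step := (play A C M).

Definition run_state (c : nat) : nat := nsnd (nsnd c).
Definition run_count (c : nat) : nat := nfst (nsnd c).
Definition run_length (c : nat) : nat := nfst c.

Definition run_bit (c b : nat) : nat :=
  npair (run_length c).+1
    (if `[< b = 0 >] then npair (run_count c).+1 (run_state c)
     else npair 0 (step (run_state c) (run_count c))).

Definition run_init : nat := npair 0 (npair 0 (state 0 0 0 0)).

Definition run (s : seq bool) : nat := foldl (fun c (b : bool) => run_bit c b) run_init s.

Lemma run_rcons s b : run (rcons s b) = run_bit (run s) b.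
Proof. by rewrite /run -cats1 foldl_cat. Qed.

Lemma run_length_size s : run_length (run s) = size s.
Proof.
elim/last_ind: s => [|s b IH]; first by rewrite /run_length nfstK.
by rewrite run_rcons size_rcons /run_bit /run_length nfstK -IH.
Qed.

Lemma run_rcons_false s :
  run_state (run (rcons s false)) = run_state (run s) /\
  run_count (run (rcons s false)) = (run_count (run s)).+1.
Proof.
by rewrite run_rcons /run_bit asboolT // /run_state /run_count !(nfstK, nsndK).
Qed.

Lemma run_rcons_true s :
  run_state (run (rcons s true)) = step (run_state (run s)) (run_count (run s)) /\
  run_count (run (rcons s true)) = 0.
Proof.
by rewrite run_rcons /run_bit asboolF // /run_state /run_count !(nfstK, nsndK).
Qed.

Lemma run_zeros s m : exists t, [/\ prefix s t,
  run_state (run t) = run_state (run s) & run_count (run t) = run_count (run s) + m].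
Proof.
elim: m => [|m [t [st ts tc]]].
  by exists s; rewrite addn0; split=> //; exact: prefix_refl.
exists (rcons t false); have [-> ->] := run_rcons_false t.
rewrite ts tc addnS; split=> //.
exact: prefix_trans st (prefix_rcons _ _).
Qed.

Lemma step_idle st m : 6 <= m -> step st m = st.
Proof. by move=> m6; rewrite /play; do ?[rewrite asboolF; last by lia]. Qed.

Lemma run_reset s : exists t, [/\ prefix s t,
  run_state (run t) = run_state (run s) & run_count (run t) = 0].
Proof.
have [t [st ts tc]] := run_zeros s 6.
exists (rcons t true); have [-> ->] := run_rcons_true t; rewrite ts tc.
split=> //; first exact: prefix_trans st (prefix_rcons _ _).
by apply: step_idle; lia.
Qed.

Lemma run_step s m : exists t, prefix s t /\
  run_state (run t) = step (run_state (run s)) m.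
Proof.
have [t [st ts tc]] := run_reset s; have [u [tu us uc]] := run_zeros t m.
exists (rcons u true); have [-> _] := run_rcons_true u; rewrite us ts uc tc.
split=> //; apply: prefix_trans st (prefix_trans tu (prefix_rcons _ _)).
Qed.

Lemma run_reach s st : reach A C M (run_state (run s)) st ->
  exists t, prefix s t /\ run_state (run t) = st.
Proof.
move: st; apply: reach_ind; first by exists s; split=> //; exact: prefix_refl.
move=> st _ [t [pt <-]] m; have [u [tu uE]] := run_step t m.
by exists u; split=> //; exact: prefix_trans tu.
Qed.

Lemma reach_run s b :
  reach A C M (run_state (run s)) (run_state (run (rcons s b))).
Proof.
case: b; first by have [-> _] := run_rcons_true s; exact: reach_step.
by have [-> _] := run_rcons_false s; exact: reach_refl.
Qed.

Definition run_code (n : nat) : nat := nfst (iter n (fun p =>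
  if `[< nsnd p = 0 >] then p
  else npair (run_bit (nfst p) (odd (nsnd p).-1)) ((nsnd p).-1)./2)
  (npair run_init n)).

Lemma run_codeE s : run_code (string_code s) = run s.
Proof.
rewrite /run_code /run; set f := (fun p : nat => _).
have fS c b t : f (npair c (string_code (b :: t))) =
    npair (run_bit c b) (string_code t).
  rewrite /f !(nfstK, nsndK) /= -/(string_code t) asboolF; last by lia.
  have -> : (b + (string_code t).*2.+1).-1 = b + (string_code t).*2 by lia.
  by rewrite oddD odd_double addbF half_bit_double; case: b.
have f0 c : f (npair c 0) = npair c 0 by rewrite /f nsndK asboolT.
have iter0 n c : iter n f (npair c 0) = npair c 0.
  by elim: n => //= n ->.
have le t : size t <= string_code t.
  by elim: t => //= b t IH; rewrite -/(string_code t); lia.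
suff H n c : size s <= n -> nfst (iter n f (npair c (string_code s))) =
    foldl (fun c (b : bool) => run_bit c b) c s by apply: H; exact: le.
elim: s n c => [|b s IH] n c; first by rewrite iter0 nfstK.
by case: n => // n sn; rewrite iterSr fS /=; exact: IH.
Qed.

Section RecRun.
Variable X : set nat.
Hypothesis rstep : recf X (fun p => step (nfst p) (nsnd p)).

Lemma recf_run_bit f g : recf X f -> recf X g ->
  recf X (fun n => run_bit (f n) (g n)).
Proof.
move=> rf rg; rewrite /run_bit /run_length /run_count /run_state.
apply: recf_npair; first by rec.
apply: recf_if; [by rec|by rec|apply: recf_npair; first by rec].
by apply: (recf_comp2 rstep); rec.
Qed.

Lemma recf_run_code : recf X run_code.
Proof.
rewrite /run_code; apply: recf_nfst; apply: recf_iter; [|by rec|by rec].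
apply: recf_if; [by rec|by rec|apply: recf_npair].
  apply: recf_run_bit; first by rec.
  by apply: recf_odd; rec.
by apply: recf_half; rec.
Qed.

Lemma recf_run_along G : recp X G ->
  recf X (fun k => run (mkseq (fun i => `[< G i >]) k)).
Proof.
move=> rG; apply: (@recf_ext _ (fun k => prim (fun i c => run_bit c `[< G i >])
    run_init k)).
  elim=> [|k IH] //=; rewrite /mkseq -addn1 iotaD map_cat cats1 run_rcons.
  by rewrite /= -IH.
apply: recf_prim; [|by rec|by rec].
by apply: recf_run_bit; rec.
Qed.

End RecRun.

End Run.

Section Generic.
Variables A C M G : set nat.
Hypotheses (rA : recp (jump set0) A) (rC : recp (jump set0) C).
Hypothesis low : recp (jump set0) (facts M).
Hypothesis sM : forall u, scott u M.
Hypothesis hG : two_generic G.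
Hypothesis colorful : forall l i, unbounded (reservoir M l) ->
  unbounded (reservoir M l `&` color i A).
Local Notation R := (reservoir M).
Local Notation step := (play A C M).
Local Notation reach := (reach A C M).
Local Notation settled := (pair_settled C M).

Definition segment (k : nat) : seq bool := mkseq (fun i => `[< G i >]) k.
Definition at_time (k : nat) : nat := run_state (run A C M (segment k)).

Lemma segmentS k : segment k.+1 = rcons (segment k) `[< G k >].
Proof. by rewrite /segment /mkseq -addn1 iotaD map_cat cats1. Qed.

Lemma initial_segmentE s : initial_segment s G -> s = segment (size s).
Proof.
move=> sG; apply: (@eq_from_nth _ false); first by rewrite size_mkseq.
move=> i si; rewrite nth_mkseq //; apply/idP/asboolP; by move/(sG i si).
Qed.

Lemma prefix_segment k k' : k <= k' -> prefix (segment k) (segment k').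
Proof.
elim: k' => [|k' IH]; first by rewrite leqn0 => /eqP ->; exact: prefix_refl.
rewrite leq_eqVlt => /orP[/eqP <-|]; first exact: prefix_refl.
by rewrite ltnS => /IH h; rewrite segmentS; exact: prefix_trans h (prefix_rcons _ _).
Qed.

Lemma reach_time k k' : k <= k' -> reach (at_time k) (at_time k').
Proof.
elim: k' => [|k' IH]; first by rewrite leqn0 => /eqP ->; exact: reach_refl.
rewrite leq_eqVlt => /orP[/eqP <-|]; first exact: reach_refl.
rewrite ltnS => /IH h; apply: reach_trans h _.
by rewrite /at_time segmentS; exact: reach_run.
Qed.

Lemma rstep : recf (jump set0) (fun p => step (nfst p) (nsnd p)).
Proof. exact: recf_step. Qed.

Lemma generic (U : nat -> Prop) k0 : recp (jump set0) U ->
  exists k, k0 <= k /\ (U (at_time k) \/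
    forall st, reach (at_time k) st -> ~ U st).
Proof.
move=> rU.
have [||s [/initial_segmentE sE hs]] := @two_generic_dec G
  (fun n => k0 <= run_length (run_code A C M n) /\
            U (run_state (run_code A C M n))) => //.
  have rr := recf_run_code rstep.
  by rewrite /run_length /run_state; apply: recp_and; rec.
rewrite run_codeE run_length_size in hs.
case: hs => [[k0s Us]|hs].
  by exists (size s); split=> //; left; rewrite /at_time -sE.
exists (maxn k0 (size s)); split; first exact: leq_maxl.
right=> st /run_reach[t [pt <-]] Ut.
have ps : prefix (segment (size s)) t.
  by apply: prefix_trans pt; apply: prefix_segment; exact: leq_maxr.
rewrite -sE in ps; apply: (hs t ps); rewrite run_codeE run_length_size; split=> //.
have := size_prefix pt; rewrite size_mkseq; apply: leq_trans; exact: leq_maxl.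
Qed.

Lemma coherent_time k : coherent A C M (at_time k).
Proof.
apply: (@reach_coherent A C M (at_time 0)); last exact: reach_time.
have -> : at_time 0 = state 0 0 0 0.
  by rewrite /at_time /run_state /run /= /run_init !nsndK.
split=> [i n|l']; first by rewrite part_state; case: i => /lmem0.
by rewrite stack_state => /ancestor_le; rewrite leqn0 => /eqP.
Qed.

(* If [A] itself solves the splitting problem of [st], so does the column of
   [M]; otherwise [A] or its complement contains a splitting, one side of which
   disagrees with [C] and can be added to [st]. *)
Lemma solves_or_mistaken st : coherent A C M st ->
  ~ solves (R (stack st)) st (column M st) ->
  exists st', [/\ reach st st', stack st' = stack st & settled st' (stack st')].
Proof.
move=> [inv _] /existsNP[w /contrapT hw].
have [w1 /refutesP[i]] : exists w, refutes (R (stack st)) st A w.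
  apply: contrapT => /forallNP hA.
  have [z [_ hz]] := initial_lst A w.+1.
  have := @sM (npair st (npair w.+1 z)); rewrite /scott !(nfstK, nsndK).
  move=> /(_ _ w (ltnSn w)); apply => // w' ww' h; apply: (hA w'); move: h.
  by apply: refutes_local => // n nw; rewrite hz; split=> [[]|] //; split=> //; lia.
move=> [L1 [_ [L2 [_ [x [_ [v1 [_ [v2 [_ [v12 [h1 h2]]]]]]]]]]]].
have [L [v [vC h]]] : exists L (v : nat), v <> `[< C x >] /\ converges
    (functional i (depth (stack st))) (part i st) (bound st)
    (R (stack st) `&` color i A) L x v.
  have [v1C|v1C] := EM (v1 = `[< C x >]).
    by exists L2, v2; split=> //; rewrite -v1C => v21; exact: v12.
  by exists L1, v1.
have [vL [mL [cL hZ]]] := h.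
pose E := [set n | bound st <= n /\ lmem (ent 4 n 1) L].
have EL n : E n -> n < L.
  by move=> [_ nL]; have [_ ? _] := ent_ge 4 n 1; have := lmem_lt nL; lia.
have EZ n : E n -> (R (stack st) `&` color i A) n.
  by move=> En; have [bn nL] := En; apply: hZ => //; exact: EL.
have [||st' [r s b p]] := @fill A C M st E (maxn (bound st) L.+1).
- by move=> n /EZ[].
- exact: leq_maxl.
exists st'; split=> //.
have mis : mistaken C (functional i (depth (stack st'))) (part i st') (bound st').
  have [_ xL vL'] := ent_ge (functional i (depth (stack st))) x v.
  have eL := lmem_lt mL.
  exists L; split; first by rewrite b; lia.
  exists x; split; first by lia.
  exists v; split; first by lia.
  rewrite s; split=> //; split=> //; split=> //.
  apply: consist_local cL => n nL; rewrite /lset /= p.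
  split=> [[|En]|[|[? _ [? ?] _]]]; [by left| |by left|by right].
  by right; split=> //; [case: En | lia | have [] := EZ _ En].
by apply: (@settledW C M i); right.
Qed.

(* If one side of the solution were finite, the reservoir would, above a large
   bound, be contained in the other side, and so settle the pair by itself. *)
Lemma branch_unbounded st fl : coherent A C M st -> fl < 2 ->
  unbounded (R (stack st)) -> solves (R (stack st)) st (column M st) ->
  (forall st', reach st st' -> stack st' = stack st ->
     ~ settled st' (stack st')) ->
  unbounded (R (branch st fl)).
Proof.
move=> [inv _] fl2 u sol nset; apply: contrapT => /existsNP[n /forallNP hn].
have [|st' [r s b p]] := @pad A C M st (maxn n (bound st)); first exact: leq_maxr.
apply: (nset st' r s).
pose i := fl == 0.
have cst : constant_on (functional i (depth (stack st))) (part i st) (bound st)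
    (R (stack st) `&` color i (column M st)).
  by move=> w hw; apply: (sol w); apply/refutesP; exists i.
have : constant_on (functional i (depth (stack st'))) (part i st') (bound st')
    (R (stack st')).
  rewrite s; apply: constant_weaken cst => //.
  - by move=> m /inv[].
  - by rewrite b leq_maxr.
  - move=> m; rewrite b => nm Rm; split=> //; have := hn m.
    rewrite reservoir_branch /i; case: fl fl2 {hn i} => [|[|//]] _ /= h.
      by move=> cm; apply: h; split; first by lia.
    by apply: contrapT => cm; apply: h; split; first by lia.
by move=> c; apply: (@settledW C M i); left.
Qed.

(* If [G] never settles the pair [depth l] by move 3, then by genericity some
   initial segment excludes this move for good, and from then on every solution
   pushed on [l] has two infinite sides. *)
Lemma deepen k l j : ancestor l (stack (at_time k)) -> unbounded (R l) ->
  depth l = j -> exists k' l', [/\ ancestor l' (stack (at_time k')),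
    unbounded (R l') & depth l' = j.+1].
Proof.
move=> anc u dl.
have child k' s : ancestor s (stack (at_time k')) -> s <> 0 -> below s = l ->
    unbounded (R s) -> exists k' l', [/\ ancestor l' (stack (at_time k')),
    unbounded (R l') & depth l' = j.+1].
  move=> a s0 bs us; exists k', s; split=> //.
  by have [_ /(_ s a s0)[_ _ -> _]] := coherent_time k'; rewrite bs dl.
have [|k1 [kk1 [[s [a s0 [bs fs]]]|noU1]]] := @generic
    (fun st => exists s, [/\ ancestor s (stack st), s <> 0 &
      below s = l /\ flag s = 2]) k.
- by apply: (@recp_ancestor _ (fun s => below s = l /\ flag s = 2)); rec.
- apply: (child _ _ a s0 bs) => n; have [x [nx Rx]] := u n; exists x; split=> //.
  by apply/(reservoirS M x s0); rewrite /side fs bs.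
have {}anc : ancestor l (stack (at_time k1)).
  exact: (ancestor_reach u (reach_time kk1)).
have nset st : reach (at_time k1) st -> stack st = l -> ~ settled st (stack st).
  move=> r sl hs; have [oE fE _ bE] := branchK st 2.
  apply: (noU1 (step st 3)); first exact: reach_trans (reach_step _ _ _ _ _).
  exists (branch st 2); rewrite bE fE; split=> //.
  rewrite /play asboolF // asboolF // asboolF; last by case.
  by rewrite asboolT // stack_restack; exact: ancestor_refl.
have coh st : reach (at_time k1) st -> coherent A C M st.
  exact: reach_coherent (coherent_time k1).
have sol st : reach (at_time k1) st -> stack st = l ->
    solves (R (stack st)) st (column M st).
  move=> r sl; apply: contrapT => /(solves_or_mistaken (coh _ r))[st' [r' s' h]].
  by apply: (nset st') h; [exact: reach_trans r' | rewrite s'].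
have [|k2 [k12 [sl|noU2]]] := @generic (fun st => stack st = l) k1; first by rec.
- have bigchild st : reach (at_time k2) st -> forall s, ancestor s (stack st) ->
      s <> 0 -> below s = l -> unbounded (R s).
    move: st; apply: reach_ind.
      rewrite sl => s /ancestor_le sl' s0 bs.
      by have := below_lt s0; rewrite bs; lia.
    move=> st r IH m s; case: (stack_stepP A C M st m) => [->|[_ ->]|]; first exact: IH.
      by move=> a; apply: IH; exact: ancestor_trans (ancestor_below _).
    have r1 : reach (at_time k1) st by exact: reach_trans (reach_time k12) r.
    move=> [fl [sE _ hfl]]; rewrite sE => /ancestorE[->|a] s0; last first.
      by apply: IH => //; move: a; have [_ _ _ ->] := branchK st fl.
    have [_ fE _ bE] := branchK st fl; rewrite bE => sl'.
    case: hfl => [[fl2 _]|[fl2 hsol]].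
      case: (noU1 (step st m)).
        exact: reach_trans r1 (reach_step _ _ _ _ _).
      exists (branch st fl); rewrite bE fE sE; split=> //; exact: ancestor_refl.
    apply: branch_unbounded => //; rewrite ?sl' //; first exact: coh.
    by move=> st' r' s'; apply: nset => //; exact: reach_trans r'.
  have [|k3 [k23 [[s [a s0 bs]]|noU3]]] := @generic
    (fun st => exists s, [/\ ancestor s (stack st), s <> 0 & below s = l]) k2.
  + by apply: (@recp_ancestor _ (fun s => below s = l)); rec.
  + by apply: (child _ _ a s0 bs); apply: (bigchild _ _ s a s0 bs); exact: reach_time.
  + have [st' [r' a' u']] := pop_to_unbounded A C M (at_time k3).
    have [sl'|sl'] := EM (stack st' = l); last first.
      have := ancestor_reach u (reach_trans (reach_time k23) r').
      rewrite sl => /(_ (ancestor_refl _)) /ancestor_child.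
      move=> /(_ (fun e => sl' (esym e)))[s [as_ s0 bs]].
      by case: (noU3 st' r'); exists s.
    have [oE fE _ bE] := branchK st' 0.
    case: (noU3 (step st' 4)); first exact: reach_trans r' (reach_step _ _ _ _ _).
    exists (branch st' 0); rewrite bE; split=> //.
    rewrite /play asboolF // asboolF // asboolF; last by case.
    rewrite asboolF; last by case.
    rewrite asboolT ?stack_restack; first exact: ancestor_refl.
    split; first by left.
    apply: sol => //; apply: reach_trans r'; apply: reach_time; lia.
have [st' [r' a' u']] := pop_to_unbounded A C M (at_time k2).
have al : ancestor l (stack st').
  by apply: (ancestor_reach u _ anc); exact: reach_trans (reach_time k12) r'.
have ne : l <> stack st' by move=> e; apply: (noU2 st' r').
have [s [as_ s0 bs]] := ancestor_child al ne.
apply: (child k2 s) => //; first exact: ancestor_trans as_ a'.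
move=> n; have [x [nx Rx]] := u' n; exists x; split=> //.
exact: ancestor_reservoir as_ _ Rx.
Qed.

Lemma deep j : exists k l, [/\ ancestor l (stack (at_time k)),
  unbounded (R l) & depth l = j].
Proof.
elim: j => [|j [k [l [a u d]]]]; last exact: deepen a u d.
exists 0, 0; split; first exact: ancestor0.
  by move=> n; exists n.
by rewrite /depth asboolT.
Qed.

Definition limit (i : bool) : set nat :=
  [set x | exists k, lmem x (part i (at_time k))].

Lemma limit_color i : limit i `<=` color i A.
Proof. by move=> x [k]; have [h _] := coherent_time k; move=> /h[]. Qed.

Lemma limit_part i k x : x < bound (at_time k) ->
  limit i x <-> lmem x (part i (at_time k)).
Proof.
move=> xb; split=> [[k' h]|]; last by exists k.
have [kk'|k'k] := leqP k k'; first exact/(part_reach _ (reach_time kk')).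
have [inv _] := coherent_time k'; have [xb' _] := inv _ _ h.
exact/(part_reach _ (reach_time (ltnW k'k))).
Qed.

Lemma limit_unbounded i : unbounded (limit i).
Proof.
move=> n; have [|k [_ [[x [_ [nx hx]]]|nU]]] := @generic
  (fun st => exists x, x < part i st /\ (n <= x /\ lmem x (part i st))) 0.
- have rp : recf (jump set0) (fun st => part i st) by apply: recf_part; rec.
  by apply: recp_bex => //; apply: recp_and; first rec; apply: recp_lmem;
    [rec | apply: recf_part; rec].
- by exists x; split=> //; exists k.
have [st [r a u]] := pop_to_unbounded A C M (at_time k).
have [x [xn [Rx cx]]] := colorful i u (maxn n (bound st)).
have [||st' [r' s' b' p']] := @fill A C M st [set x] x.+1.
- by move=> _ ->.
- by lia.
case: (nU st'); first exact: reach_trans r r'.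
have h : lmem x (part i st') by apply/p'; right; split=> //; lia.
by exists x; split; [exact: lmem_lt | split=> //; lia].
Qed.

Lemma time_bound x : exists k, x < bound (at_time k).
Proof.
have [y [xy [k hk]]] := limit_unbounded false x; exists k.
have [inv _] := coherent_time k; have [yb _] := inv _ _ hk; lia.
Qed.

Lemma limit_join i : turing_le (limit i) (join G (jump set0)).
Proof.
have rG := @recp_join_left G (jump set0).
have rJ := @recp_join_right G (jump set0).
have rs := recf_trans rJ rstep.
have rt : recf (join G (jump set0)) at_time.
  have rr := recf_run_along rs rG.
  by rewrite /at_time /run_state /segment; rec.
have [||f [rf hf]] := @recf_choose (join G (jump set0))
  (fun x k => x < bound (at_time k)); [by rec|exact: time_bound|].
suff : recp (join G (jump set0)) (limit i) by [].
apply: (@recp_iff _ (fun x => lmem x (part i (at_time (f x))))).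
  by move=> x; apply: iff_sym; exact: limit_part.
by apply: recp_lmem; [rec | apply: recf_part; rec].
Qed.

Lemma limit_avoids : ~ turing_le C M ->
  exists i, ~ turing_le C (limit i).
Proof.
move=> nCM; apply: contrapT => /forallNP h.
have /contrapT[c0 hc0] := h false; have /contrapT[c1 hc1] := h true.
pose c i := godel (if i then c1 else c0).
have hc i x : facts (limit i) (ent (c i) x `[< C x >]).
  by apply/factsP; case: i.
have fc i : functional i (npair (c false) (c true)) = c i.
  by case: i; rewrite /functional ?nfstK ?nsndK.
have [k [l [a u d]]] := deep (npair (c false) (c true)).+1.
have l0 : l <> 0 by move=> e; move: d; rewrite e /depth asboolT.
have [_ /(_ l a l0)[bl sl dl pl]] := coherent_time k.
have de : depth (stack (origin l)) = npair (c false) (c true).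
  by move: dl; rewrite d => -[].
have low_part i n : n < bound (origin l) ->
    limit i n <-> lmem n (part i (origin l)).
  move=> nb; rewrite (@limit_part i k); first exact: (pl i n).1.
  exact: leq_trans nb bl.
have high_part i n : limit i n -> bound (origin l) <= n -> R l n.
  move=> [k' hk'] bn; pose m := maxn k k'.
  have am : ancestor l (stack (at_time m)).
    by apply: (ancestor_reach u _ a); apply: reach_time; exact: leq_maxl.
  have [inv /(_ l am l0)[_ _ _ /(_ i n)[_ [_ +]]]] := coherent_time m.
  apply=> //; have [inv' _] := coherent_time k'.
  apply/(part_reach _ (@reach_time k' m _)) => //; first exact: leq_maxr.
  by have [] := inv' _ _ hk'.
have no i : ~ settled_at C M i (origin l) l.
  rewrite /settled_at de fc => -[cst|].
    apply: nCM; apply: (constant_computes _ _ _ _ cst (hc i)).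
    - by apply: (@recp_reservoir M (fun _ n => M n)); have := recp_oracle M => ?; rec.
    - move=> n hn; apply/low_part => //; exact: (pl i n).2.1.
    - by move=> n hn nb; apply/low_part.
    - by move=> n; exact: high_part.
  move=> [L [Lb [x [_ [v [_ [vL [mL [cL vC]]]]]]]]]; apply: vC.
  apply: (facts_det _ (hc i x)); exists L; split=> //.
  apply: consist_local cL => n nL; apply: iff_sym; apply: low_part; lia.
by case: sl => /no.
Qed.

End Generic.

Lemma unbounded_infinite (Z : set nat) : unbounded Z -> infinite_set Z.
Proof.
move=> u /finite_seqP[s Zs].
have le x : x \in s -> x <= foldr maxn 0 s.
  elim: s {Zs} => //= y s IH; rewrite inE => /orP[/eqP ->|/IH]; lia.
have [x [lx]] := u (foldr maxn 0 s).+1.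
by rewrite Zs /= => /le; rewrite leqNgt lx.
Qed.

Lemma homogeneous_tail (A C M G : set nat) l i :
  recp (jump set0) (facts M) -> ~ turing_le C M ->
  unbounded (reservoir M l) -> ~ unbounded (reservoir M l `&` color i A) ->
  exists H : set nat, [/\ turing_le H (join G (jump set0)), infinite_set H,
    H `<=` color (~~ i) A & ~ turing_le C H].
Proof.
move=> low nCM u /existsNP[n /forallNP hn].
pose H := [set x | n <= x /\ reservoir M l x].
have rH : recp M H.
  have rR : recp M (reservoir M l).
    by apply: (@recp_reservoir M (fun _ n => M n)); have := recp_oracle M => ?; rec.
  by rewrite /H; apply: recp_and; rec.
exists H; split.
- exact: recp_trans (@recp_join_right G (jump set0)) (low_jump low rH).
- apply: unbounded_infinite => m; have [x [mx Rx]] := u (maxn n m).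
  by exists x; split; [lia | split=> //; lia].
- move=> x [nx Rx]; have := hn x; case: i {hn} => /= h.
    by apply: contrapT => nA; apply: h.
  by move=> Ax; apply: h.
- by move=> CH; apply: nCM; exact: recp_trans rH CH.
Qed.

Theorem theorem4p2 (A C : set nat) (hA : Delta02 A) (hC : Delta02 C)
    (hCnc : ~ turing_le C set0) (G : set nat) (hG : two_generic G) :
  exists H : set nat,
    [/\ turing_le H (join G (jump set0)),
        infinite_set H,
        H `<=` A \/ H `<=` ~` A
      & ~ turing_le C H].
Proof.
have rA := Delta02_jump hA; have rC := Delta02_jump hC.
have [M [sM low nCM]] := low_cone_avoiding_scott rC hCnc.
have [colorful|] := EM (forall l i, unbounded (reservoir M l) ->
  unbounded (reservoir M l `&` color i A)); last first.
  move=> /existsNP[l /existsNP[i /not_implyP[u nu]]].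
  have [H [HG Hinf HA CH]] := homogeneous_tail G low nCM u nu.
  by exists H; split=> //; case: i HA {nu} => ?; [left|right].
have [i nC] := limit_avoids rA rC low sM hG nCM.
exists (limit A C M G i); split=> //.
- exact: limit_join.
- by apply: unbounded_infinite; exact: limit_unbounded.
- have := @limit_color A C M G i.
  by case: i {nC} => h; [right|left].
Qed.
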